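(* There is an absolute constant $C$ such that for all integers $k\ge2$ and reals $q\ge1$, $s\ge k$: if every planar $k$-terminal network whose terminals all lie on one face admits a minor cut sparsifier of quality $q$ and size $s$, then every planar $k$-terminal network whose terminals all lie on one face admits a $(q,Cs)$-distance-approximating minor.
   Context: A $k$-terminal network $G=(V,E,T,c)$ is a finite connected undirected graph with nonnegative edge weights $c$ and a set $T\subseteq V$ of $k$ terminals. For $S\subset T$, $S\neq\emptyset,T$, $\mathrm{mincut}_G(S)$ is the minimum total weight of edges with exactly one endpoint in $W$, over $W\subseteq V$ with $W\cap T\in\{S,T\setminus S\}$. A network $H=(V_H,E_H,T,c_H)$ with the same terminals is a cut sparsifier of $G$ of quality $q$ and size $s$ if $|V_H|\le s$ and $\mathrm{mincut}_G(S)\le\mathrm{mincut}_H(S)\le q\,\mathrm{mincut}_G(S)$ for all such $S$; it is a minor cut sparsifier if moreover $H$ is a minor of $G$ (terminals remaining distinct vertices). With $c$ viewed as edge lengths, $d_G$ denotes the shortest-path metric; $H$ is a $(q,s)$-distance-approximating minor (DAM) of $G$ if $H$ is a minor of $G$ with terminal set $T$, $|V_H|\le s$, and $d_G(t,t')\le d_H(t,t')\le q\,d_G(t,t')$ for all $t,t'\in T$. *)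

(* Defs.v *)
From HB Require Import structures.
From mathcomp Require Import all_boot all_order all_algebra.
From mathcomp Require Import fingroup perm.
From mathcomp Require Import classical_sets reals Rstruct.
Set Implicit Arguments. Unset Strict Implicit. Unset Printing Implicit Defensive.
Import Order.TTheory GRing.Theory Num.Theory.
Local Open Scope ring_scope.

Notation R := Rdefinitions.R.

Section Networks.
Variables (V : finType) (e : rel V) (c : V -> V -> R).

(* A k-terminal network: finite connected undirected (simple) graph e on V,
   nonnegative symmetric edge weights c (values off edges are irrelevant),
   and k distinct terminals t 0, ..., t (k-1). *)
Definition is_network (k : nat) (t : 'I_k -> V) : Prop :=
  [/\ symmetric e /\ irreflexive e,
      (forall x y, e x y -> c x y = c y x),
      (forall x y, e x y -> 0 <= c x y),
      injective t &
      (forall x y, connect e x y)].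

Definition cut_weight (W : {set V}) : R :=
  \sum_(x in W) \sum_(y in ~: W | e x y) c x y.

Definition mincut (k : nat) (t : 'I_k -> V) (S : {set 'I_k}) : R :=
  inf [set r | exists W : {set V},
        ([set i | t i \in W]%SET = S \/ [set i | t i \in W]%SET = ~: S) /\ r = cut_weight W]%classic.

Definition walk_length (u : V) (p : seq V) : R :=
  \sum_(xy <- zip (u :: p) p) c xy.1 xy.2.

Definition dist (u v : V) : R :=
  inf [set r | exists p : seq V, [/\ path e u p, last u p = v & r = walk_length u p]]%classic.

Definition dartP (p : V * V) : bool := e p.1 p.2 && e p.2 p.1.
Definition dart := {p : V * V | dartP p}.

Lemma dartP_rev (p : V * V) : dartP p -> dartP (p.2, p.1).
Proof. by rewrite /dartP /= andbC. Qed.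

Definition dart_rev (d : dart) : dart :=
  exist _ ((val d).2, (val d).1) (dartP_rev (valP d)).

Definition dart_tail (d : dart) : V := (val d).1.

Definition rotation_system (sigma : {perm dart}) : Prop :=
  (forall d, dart_tail (sigma d) = dart_tail d) /\
  (forall d d', dart_tail d = dart_tail d' -> fconnect sigma d d').

(* face permutation: the faces are its orbits *)
Definition face_perm (sigma : {perm dart}) (d : dart) : dart := sigma (dart_rev d).

(* Euler's formula |V| - |E| + |F| = 2 (with |E| = #darts / 2): genus 0 *)
Definition genus0 (sigma : {perm dart}) : Prop :=
  (2 * #|V| + 2 * fcard (face_perm sigma) (predT : {pred dart}) = #|{: dart}| + 4)%N.

Definition planar_terminals_one_face (k : nat) (t : 'I_k -> V) : Prop :=
  exists sigma : {perm dart}, [/\ rotation_system sigma, genus0 sigma &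
    exists d0 : dart, forall i, exists d : dart,
      fconnect (face_perm sigma) d0 d /\ dart_tail d = t i].

End Networks.

Definition minor_model (V VH : finType) (e : rel V) (eH : rel VH)
    (phi : VH -> {set V}) : Prop :=
  [/\ (forall u, phi u != finset.set0),
      (forall u v, u != v -> [disjoint phi u & phi v]%SET),
      (forall u x y, x \in phi u -> y \in phi u ->
          connect [rel a b | [&& e a b, a \in phi u & b \in phi u]] x y) &
      (forall u v, eH u v -> exists x y, [/\ x \in phi u, y \in phi v & e x y])].

Definition is_minor_terminals (V VH : finType) (e : rel V) (eH : rel VH)
    (k : nat) (t : 'I_k -> V) (tH : 'I_k -> VH) : Prop :=
  exists phi : VH -> {set V}, minor_model e eH phi /\ forall i, t i \in phi (tH i).

Definition has_minor_cut_sparsifier (V : finType) (e : rel V) (c : V -> V -> R)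
    (k : nat) (t : 'I_k -> V) (q s : R) : Prop :=
  exists (VH : finType) (eH : rel VH) (cH : VH -> VH -> R) (tH : 'I_k -> VH),
    [/\ is_network eH cH tH, is_minor_terminals e eH t tH, (#|VH|%:R <= s)%R &
      forall S : {set 'I_k}, S != finset.set0 -> S != finset.setT ->
        (mincut e c t S <= mincut eH cH tH S <= q * mincut e c t S)%R].

Definition has_DAM (V : finType) (e : rel V) (c : V -> V -> R)
    (k : nat) (t : 'I_k -> V) (q s : R) : Prop :=
  exists (VH : finType) (eH : rel VH) (cH : VH -> VH -> R) (tH : 'I_k -> VH),
    [/\ is_network eH cH tH, is_minor_terminals e eH t tH, (#|VH|%:R <= s)%R &
      forall i j : 'I_k,
        (dist e c (t i) (t j) <= dist eH cH (tH i) (tH j) <= q * dist e c (t i) (t j))%R].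

(* Main.v *)
Require Import Defs.
From HB Require Import structures.
From mathcomp Require Import all_boot all_order all_algebra.
From mathcomp Require Import fingroup perm.
From mathcomp Require Import classical_sets reals Rstruct.
From mathcomp Require Import zify ring.
Set Implicit Arguments. Unset Strict Implicit. Unset Printing Implicit Defensive.
Import Order.TTheory GRing.Theory Num.Theory.
Local Open Scope ring_scope.

(** The proof is planar duality.  Split the outer face of G at the terminals and
    take the dual; it is again a plane network with k terminals on one face, and a
    minimum cut of the dual separating the arc of terminals between t_i and t_j is a
    shortest path of G from t_i to t_j.  Given a minor cut sparsifier H of the dual,
    keep in G one edge for every edge of H, delete the edges dual to those inside the
    branch sets of H and contract all others: this is the dual of H, so its distances
    are minimum cuts of H.  Every nonterminal vertex of it is bounded by a cycle of
    the simple graph H and these cycles span the cycle space, which by counting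
    bounds the number of vertices by 3 |V(H)|.

    All duality is carried out with chains over F_2: subsets of edges that are closed
    away from the terminals are exactly the cuts of the dual. *)

(** * Permutations and linear systems *)

(** Genus 0 is used only through Euler's formula: it makes two ranks add up to the number of edges,
    which turns the orthogonality of face and vertex coboundaries into exactness. No Jordan curve
    argument is needed. Splitting the outer face at the terminals is the same surgery as fusing all
    terminals into one vertex: a cyclic permutation [tau] of one chosen dart per terminal, composed
    with the face permutation, cuts the outer orbit into [k] orbits and, composed with the rotation,
    joins the [k] vertex orbits into one. The fused vertex is the face of the dual on which the new
    terminals lie. The dual of a simple graph can have loops and parallel edges, which a relation on
    vertices cannot express; hence the subdivided dual. The sparsifier H comes without an embedding,
    so its dual is never formed on its own: the contraction takes place in G, and H enters only
    through its branch sets and one chosen edge for each of its edges. *)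

Section PermutationSurgery.
Variable D : finType.
Implicit Types (s t : {perm D}) (x y z : D).
Local Open Scope nat_scope.
Local Open Scope group_scope.

Lemma porbit_invariant (T : Type) (h : D -> T) s x y :
  (forall z, h (s z) = h z) -> y \in porbit s x -> h y = h x.
Proof.
move=> hs /porbitP[i ->]; elim: i => [|i IH]; first by rewrite expg0 perm1.
by rewrite expgSr permM hs.
Qed.

Lemma porbit_step s x z : (s z \in porbit s x) = (z \in porbit s x).
Proof. by rewrite -!eq_porbit_mem; congr (_ == _); exact: (porbit_perm s 1). Qed.

Lemma porbits_mulr_tperm s x y :
  #|porbits (s * tperm x y)| + (x \notin porbit s y).*2 = #|porbits s| + (x != y).
Proof.
rewrite -(porbitsV s) -(porbitsV (s * _)) invMg tpermV -porbits_mul_tperm.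
by rewrite porbitV.
Qed.

Lemma porbits_split s x y : x != y -> x \in porbit s y ->
  #|porbits (s * tperm x y)| = #|porbits s|.+1 /\ x \notin porbit (s * tperm x y) y.
Proof.
move=> xy sxy; have := porbits_mulr_tperm s x y; rewrite sxy xy addn0 addn1 => E; split => //.
have := porbits_mulr_tperm (s * tperm x y) x y.
by rewrite -mulgA tperm2 mulg1 E xy; case: (_ \notin _) => //=; lia.
Qed.

Lemma porbits_merge s x y : x \notin porbit s y ->
  #|porbits (s * tperm x y)|.+1 = #|porbits s| /\ x \in porbit (s * tperm x y) y.
Proof.
move=> sxy; have xy : x != y by apply: contraNneq sxy => ->; exact: porbit_id.
have := porbits_mulr_tperm s x y; rewrite sxy xy => /= E; split; first lia.
have := porbits_mulr_tperm (s * tperm x y) x y.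
by rewrite -mulgA tperm2 mulg1 xy; case: (x \in _) => //=; lia.
Qed.

(* A cyclic permutation tau of the given elements: composing with it splits the orbit
   of psi holding them (the outer face) and merges their orbits of sigma (the terminals). *)
Lemma orbit_splitting_cycle (V : eqType) (psi sigma : {perm D}) (tl : D -> V) (a : D) (l : seq D) :
  uniq (a :: l) -> {in a :: l, forall x, x \in porbit psi a} ->
  (forall z, tl (sigma z) = tl z) -> {in a :: l &, injective tl} ->
  exists tau : {perm D},
   [/\ forall z, z \notin a :: l -> tau z = z,
       forall P : D -> bool, (forall z, P (tau z) = P z) ->
          {in a :: l, forall x, P x = P a},
       #|porbits (psi * tau)| = #|porbits psi| + size l,
       {in a :: l &, forall x y, x \in porbit (psi * tau) y -> x = y} &
       #|porbits (sigma * tau)| + size l = #|porbits sigma| /\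
       {in a :: l, forall x, x \in porbit (sigma * tau) a}].
Proof.
move=> U inO tls; elim: l U inO => [|y l IH] U inO tinj.
  exists 1; split.
  - by move=> z _; rewrite perm1.
  - by move=> P _ x; rewrite inE => /eqP ->.
  - by rewrite mulg1 addn0.
  - by move=> x z; rewrite !inE => /eqP -> /eqP ->.
  - by rewrite mulg1 addn0; split=> // x; rewrite inE => /eqP ->; exact: porbit_id.
have sub : {subset a :: l <= [:: a, y & l]}.
  by move=> x; rewrite !inE => /orP[->|->]; rewrite ?orbT.
have [|||tau [t0 tP cpsi dpsi [csig osig]]] := IH.
- by move: U => /= /andP[]; rewrite inE negb_or => /andP[_ ->] /andP[].
- by move=> x /sub; exact: inO.
- by move=> x z /sub xa /sub za; exact: tinj.
have yin : y \in [:: a, y & l] by rewrite !inE eqxx orbT.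
have yl : y \notin a :: l.
  move: U => /= /andP[]; rewrite !inE !negb_or => /andP[ay _] /andP[-> _].
  by rewrite eq_sym ay.
have tauS z : (tau z \in a :: l) = (z \in a :: l).
  apply/idP/idP => zl; apply: contraT => zn; first by rewrite t0 // (negPf zn) in zl.
  by have /perm_inj tz := t0 _ zn; rewrite tz zl in zn.
(* On the way from [a] to [y] along [psi], [tau] alters a step only when it lands on a listed dart,
   so every dart met lies in the [psi * tau]-orbit of a listed one. The list may come in any order:
   this [x] decides where [y] enters the cycle. *)
have [x xl yx] : exists2 x, x \in a :: l & y \in porbit (psi * tau) x.
  pose P z := [exists x, (x \in a :: l) && (z \in porbit (psi * tau) x)].
  suff /existsP[x /andP[]] : P y by exists x.
  have Pin z : z \in a :: l -> P z.
    by move=> zl; apply/existsP; exists z; rewrite zl porbit_id.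
  have Ppsi z : P z -> P (psi z).
    move=> /existsP[x /andP[xl zx]].
    case: (boolP (psi z \in a :: l)) => [/Pin //|/t0 tz].
    by apply/existsP; exists x; rewrite xl -tz -permM porbit_step.
  have /porbitP[i ->] : y \in porbit psi a by apply: inO; rewrite !inE eqxx orbT.
  elim: i => [|i IHi]; last by rewrite expgSr permM; exact: Ppsi.
  by rewrite expg0 perm1; apply: Pin; rewrite inE eqxx.
have xy : x != y by apply: contraNneq yl => <-.
have ty := t0 _ yl.
have all_inv (P : D -> bool) : P x = P y -> (forall z, P ((tau * tperm x y) z) = P z) ->
    forall z, P (tau z) = P z.
  by move=> Pxy Ptau z; rewrite -(Ptau z) permM; case: tpermP => [->|->|].
exists (tau * tperm x y); split.
- move=> z; rewrite !inE !negb_or permM => /and3P[za zy zl].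
  have zl' : z \notin a :: l by rewrite inE negb_or za.
  by rewrite t0 // tpermD // eq_sym //; apply: contraNneq zl' => ->.
- move=> P PT.
  have Pxy : P x = P y.
    have := PT y; rewrite permM ty tpermR => Pyx; exact: Pyx.
  have Pl := tP _ (all_inv _ Pxy PT).
  move=> z; rewrite inE => /orP[/eqP-> //|]; rewrite inE => /orP[/eqP ->|zl].
    by rewrite -Pxy Pl.
  by apply: Pl; rewrite inE zl orbT.
- by rewrite mulgA;
     have [-> _] := porbits_split xy (etrans (porbit_sym _ _ _) yx); rewrite cpsi addnS.
- have [_ nxy] := porbits_split xy (etrans (porbit_sym _ _ _) yx); rewrite mulgA.
  have E : porbit (psi * tau) x = porbit (psi * tau) y.
    by apply/eqP; rewrite eq_porbit_mem porbit_sym.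
  have coarse u v : u \in porbit (psi * tau * tperm x y) v ->
      porbit (psi * tau) u = porbit (psi * tau) v.
    move=> uv.
    apply: (porbit_invariant (s := psi * tau * tperm x y) (h := porbit (psi * tau)) _ uv) => w.
    have Ew : porbit (psi * tau) ((psi * tau) w) = porbit (psi * tau) w by exact: (porbit_perm _ 1).
    by rewrite permM -Ew; case: tpermP => [->|->|].
  have inE2 u : u \in [:: a, y & l] -> u = y \/ u \in a :: l.
    by rewrite !inE => /or3P[->|/eqP->|->]; rewrite ?orbT; [right|left|right].
  move=> u v /inE2[->|ul] /inE2[->|vl] // uv.
  + have xv : x = v by apply: dpsi => //; rewrite -eq_porbit_mem E (coarse _ _ uv).
    by move: uv nxy; rewrite -xv porbit_sym => ->.
  + have xu : x = u by apply: dpsi => //; rewrite -eq_porbit_mem E -(coarse _ _ uv).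
    by move: uv nxy; rewrite -xu => ->.
  + by apply: dpsi => //; have := coarse _ _ uv => /eqP; rewrite eq_porbit_mem.
(* The orbit of [y] stays at the vertex of [y], since [tau] moves only darts with other tails. *)
- have xs : x \notin porbit (sigma * tau) y.
    apply/negP => xs.
    have : (tl x == tl y) = (tl y == tl y).
      apply: (porbit_invariant (s := sigma * tau) (h := fun z => tl z == tl y) _ xs) => z.
      rewrite permM -(tls z); case: (boolP (sigma z \in a :: l)) => [zl|/t0 -> //].
      have nl u : u \in a :: l -> (tl u == tl y) = false.
        move=> ul; apply/eqP => /tinj uy; move: yl.
        by rewrite -(uy (sub _ ul) yin) ul.
      by rewrite !nl // tauS.
    rewrite eqxx => /eqP /tinj xy0; move: yl.
    by rewrite -(xy0 (sub _ xl) yin) xl.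
  have [c xy'] := porbits_merge xs; rewrite mulgA; split; first by rewrite /= addnS -addSn c.
  set s := sigma * tau * tperm x y in xy' *.
  have inx z : z \in a :: l -> z \in porbit s x.
    have P2 w : ((sigma * tau) w \in porbit s x) = (w \in porbit s x).
      rewrite -[RHS]porbit_step /s [in RHS]permM; case: tpermP => [->|->|] //.
      by rewrite porbit_id porbit_sym xy'.
      by rewrite porbit_id porbit_sym xy'.
    have Pa w := @porbit_invariant bool (fun u => u \in porbit s x) _ a w P2.
    by move=> zl; rewrite (Pa _ (osig _ zl)) -(Pa _ (osig _ xl)) porbit_id.
  have xa : porbit s x = porbit s a.
    by apply/eqP; rewrite eq_sym eq_porbit_mem; apply: inx; rewrite inE eqxx.
  move=> z; rewrite inE => /orP[/eqP->|]; first exact: porbit_id.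
  rewrite inE -xa => /orP[/eqP ->|zl]; first by rewrite porbit_sym.
  by apply: inx; rewrite inE zl orbT.
Qed.

End PermutationSurgery.

(** * Ranks and kernels of matrices indexed by finite types *)

Section FiniteLinearSystems.
Variable F : fieldType.

Definition mx_of_fun (A E : finType) (M : A -> E -> F) : 'M[F]_(#|A|, #|E|) :=
  \matrix_(i, j) M (enum_val i) (enum_val j).

Definition rV_of_fun (A : finType) (w : A -> F) : 'rV[F]_#|A| :=
  \row_i w (enum_val i).

Lemma rV_of_funK (A : finType) (v : 'rV[F]_#|A|) :
  rV_of_fun (fun x => v 0 (enum_rank x)) = v.
Proof. by apply/rowP => i; rewrite mxE enum_valK. Qed.

Lemma sum_enum_val (A : finType) (f : A -> F) : \sum_x f x = \sum_(i < #|A|) f (enum_val i).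
Proof. exact: (big_enum_val (A := A)). Qed.

Lemma mul_rV_mx_of_fun (A E : finType) (M : A -> E -> F) (w : A -> F) :
  rV_of_fun w *m mx_of_fun M = rV_of_fun (fun e => \sum_x w x * M x e).
Proof.
apply/rowP => j; rewrite !mxE [RHS]sum_enum_val.
by apply: eq_bigr => i _; rewrite !mxE.
Qed.

Lemma rV_of_fun_inj (A : finType) (w w' : A -> F) :
  rV_of_fun w = rV_of_fun w' -> w =1 w'.
Proof. by move=> /rowP E x; have := E (enum_rank x); rewrite !mxE enum_rankK. Qed.

Lemma rV_of_fun_eq0 (A : finType) (w : A -> F) :
  rV_of_fun w = 0 <-> forall x, w x = 0.
Proof.
split=> [/rowP w0 x|w0]; first by have := w0 (enum_rank x); rewrite !mxE enum_rankK.
by apply/rowP => i; rewrite !mxE.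
Qed.

(** Adjoining the columns that select the coordinates in [P] makes the rows independent, and [#|P|]
    columns raise the rank by at most [#|P|]. *)
Lemma leq_rank_mx_of_fun (A E : finType) (M : A -> E -> F) (P : {set A}) :
  (forall w : A -> F, (forall e, \sum_x w x * M x e = 0) ->
     {in P, forall x, w x = 0} -> forall x, w x = 0) ->
  (#|A| <= \rank (mx_of_fun M) + #|P|)%N.
Proof.
move=> kerM; pose N : 'M[F]_(#|A|, #|P|) := \matrix_(i, j) (enum_val i == enum_val j)%:R.
have : row_free (row_mx (mx_of_fun M) N).
  rewrite -kermx_eq0; apply/rowV0P => v /sub_kermxP.
  rewrite mul_mx_row -(rV_of_funK v); set w := fun x => _.
  rewrite mul_rV_mx_of_fun => vK.
  have [wM wN] := eq_row_mx (etrans vK (esym (row_mx0 _ _ _ _))).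
  apply/rV_of_fun_eq0; apply: kerM => [|x xP]; first exact/rV_of_fun_eq0.
  move/rowP/(_ (enum_rank_in xP x)): wN; rewrite !mxE (bigD1 (enum_rank x)) //=.
  rewrite !mxE !enum_rankK enum_rankK_in // eqxx mulr1 big1 ?addr0 // => j jx.
  rewrite !mxE enum_rankK_in // -(inj_eq enum_rank_inj) enum_valK (negPf jx).
  by rewrite mulr0.
rewrite /row_free => /eqP {1}<-.
rewrite -mxrank_tr tr_row_mx -addsmxE.
apply: leq_trans (mxrank_adds_leqif _ _) _.
by rewrite !mxrank_tr leq_add2l rank_leq_col.
Qed.

(** Orthogonality puts the row space of [M] inside the kernel of [N]; the two rank bounds and the
    cardinality hypothesis make the dimensions equal. *)
Lemma row_space_of_kernel (A B E : finType) (M : A -> E -> F) (N : B -> E -> F)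
    (P : {set A}) (Q : {set B}) :
  (forall x y, \sum_e M x e * N y e = 0) ->
  (forall w : A -> F, (forall e, \sum_x w x * M x e = 0) ->
     {in P, forall x, w x = 0} -> forall x, w x = 0) ->
  (forall w : B -> F, (forall e, \sum_x w x * N x e = 0) ->
     {in Q, forall x, w x = 0} -> forall x, w x = 0) ->
  (#|E| + #|P| + #|Q| <= #|A| + #|B|)%N ->
  forall j : E -> F, (forall y, \sum_e j e * N y e = 0) ->
  exists w : A -> F, forall e, j e = \sum_x w x * M x e.
Proof.
move=> MN /leq_rank_mx_of_fun rM /leq_rank_mx_of_fun rN card j jN.
have trE : (mx_of_fun N)^T = mx_of_fun (fun e y => N y e).
  by apply/matrixP => i k; rewrite !mxE.
have subK : (mx_of_fun M <= kermx (mx_of_fun N)^T)%MS.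
  apply/sub_kermxP/matrixP => i k; rewrite !mxE -[RHS](MN (enum_val i) (enum_val k)).
  rewrite [RHS]sum_enum_val.
  by apply: eq_bigr => l _; rewrite !mxE.
have eqK : (kermx (mx_of_fun N)^T <= mx_of_fun M)%MS.
  rewrite -(mxrank_leqif_sup subK) eqn_leq mxrankS //= mxrank_ker mxrank_tr.
  have arith e a b p q r s : (a <= r + p -> b <= s + q -> e + p + q <= a + b -> e - s <= r)%N.
    by lia.
  exact: arith rM rN card.
have : (rV_of_fun j <= mx_of_fun M)%MS.
  apply: submx_trans eqK; apply/sub_kermxP; rewrite trE mul_rV_mx_of_fun.
  exact/rV_of_fun_eq0.
case/submxP => v; rewrite -(rV_of_funK v) mul_rV_mx_of_fun => /rV_of_fun_inj jE.
by eexists => e; exact: jE.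
Qed.

(** Exactness read in the other direction: [#|E|] is at most the sum of the two ranks. It later
    bounds the number of edges of H. *)
Lemma card_leq_row_space (A B E : finType) (M : A -> E -> F) (N : B -> E -> F) :
  (forall j : E -> F, (forall y, \sum_e j e * N y e = 0) ->
    exists w : A -> F, forall e, j e = \sum_x w x * M x e) ->
  (#|E| <= #|A| + #|B|)%N.
Proof.
move=> H.
have : (kermx (mx_of_fun N)^T <= mx_of_fun M)%MS.
  apply/row_subP => i; set v := row i _.
  have : v *m (mx_of_fun N)^T = 0 by rewrite /v -row_mul mulmx_ker row0.
  have -> : (mx_of_fun N)^T = mx_of_fun (fun e y => N y e).
    by apply/matrixP => k l; rewrite !mxE.
  rewrite -(rV_of_funK v) mul_rV_mx_of_fun; set j := fun e => _ => /rV_of_fun_eq0 /H[w jw].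
  apply/submxP; exists (rV_of_fun w); rewrite mul_rV_mx_of_fun.
  by apply/rowP => k; rewrite [LHS]mxE [RHS]mxE jw.
move/mxrankS; rewrite mxrank_ker mxrank_tr.
have := rank_leq_row (mx_of_fun M); have := rank_leq_row (mx_of_fun N); lia.
Qed.

End FiniteLinearSystems.

Lemma addF2K (x : 'F_2) : x + x = 0.
Proof. exact: (addrr_pchar2 (pchar_Fp (isT : prime 2))). Qed.

Lemma addF2_eq0 (x y : 'F_2) : x + y = 0 -> x = y.
Proof. by move=> /eqP; rewrite addr_eq0 (oppr_pchar2 (pchar_Fp (isT : prime 2))) => /eqP. Qed.

Lemma F2_bool (x : 'F_2) : x = (x != 0)%:R.
Proof. by case: x => [[|[|//]] i]; apply/val_inj. Qed.

Lemma boolF2_inj (a b : bool) : a%:R = b%:R :> 'F_2 -> a = b.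
Proof. by case: a; case: b. Qed.

Section FixpointFreeInvolution.
Variables (D : finType) (rev : D -> D).
Hypotheses (revK : involutive rev) (rev_neq : forall d, rev d != d).

Definition oriented (d : D) := (enum_rank d < enum_rank (rev d))%N.

Lemma oriented_rev d : oriented (rev d) = ~~ oriented d.
Proof.
rewrite /oriented revK -leqNgt ltn_neqAle; case: eqP => //= E.
have {}E := enum_rank_inj (val_inj E).
by have := rev_neq d; rewrite E eqxx.
Qed.

Lemma sum_oriented (M : nmodType) (g : D -> M) :
  \sum_d g d = \sum_(e : {d | oriented d}) (g (val e) + g (rev (val e))).
Proof.
rewrite (bigID oriented) /= [X in _ + X](reindex_inj (inv_inj revK)) /=.
rewrite [X in _ + X](eq_bigl oriented) => [|d]; last by rewrite oriented_rev negbK.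
rewrite -big_split /= (@reindex_omap _ _ _ D {d | oriented d} val insub) /= => [|d od]; last first.
  by rewrite insubT.
by apply: eq_bigl => -[d od] /=; rewrite od insubT eqxx.
Qed.

Lemma card_oriented : #|D| = (2 * #|{: {d | oriented d}}|)%N.
Proof.
have := sum_oriented (fun=> 1%N : nat); rewrite !sum_nat_const.
by rewrite muln1 => ->; rewrite mulnC.
Qed.

Lemma sum_symmetric_F2 (g : D -> 'F_2) : (forall d, g (rev d) = g d) -> \sum_d g d = 0.
Proof.
by move=> gs; rewrite sum_oriented big1 // => e _; rewrite gs addF2K.
Qed.

End FixpointFreeInvolution.

(** * Planar duality over F_2 *)

Section PlaneDual.
Variables (V D : finType) (rev : D -> D) (tail : D -> V) (sigma psi tau : {perm D}).
Variables (k : nat) (t : 'I_k -> V) (dt : 'I_k -> D) (th : 'I_k -> 'I_k) (i0 : 'I_k).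
Hypotheses (revK : involutive rev) (rev_neq : forall d, rev d != d).
Hypothesis tail_sigma : forall d, tail (sigma d) = tail d.
Hypothesis sigma_trans : forall P : D -> bool, (forall d, P (sigma d) = P d) ->
  forall x y, tail x = tail y -> P x = P y.
Hypothesis psi_rev : forall d, psi (rev d) = tau (sigma d).
Hypotheses (t_inj : injective t) (tail_dt : forall i, tail (dt i) = t i).
Hypothesis tau_dt : forall i, tau (dt i) = dt (th i).
Hypothesis tau_id : forall d, d \notin codom dt -> tau d = d.
Hypothesis dt_trans : forall P : D -> bool, (forall d, P (tau (sigma d)) = P d) ->
  forall i j, P (dt i) = P (dt j).
Hypothesis G_conn : forall h : V -> bool,
  (forall d, h (tail d) = h (tail (rev d))) -> forall x y, h x = h y.

(** Invariance under [tau \o sigma] makes [h] constant on the darts [dt i] by [dt_trans], hence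
    invariant under [tau] and so under [sigma]; then [h] descends to the vertices of the connected
    graph G. *)
Lemma dual_connected (h : D -> bool) :
  (forall d, h (psi d) = h d) -> (forall d, h (rev d) = h d) -> forall x y, h x = h y.
Proof.
move=> hpsi hrev.
have hts d : h (tau (sigma d)) = h d by rewrite -psi_rev hpsi hrev.
have htau d : h (tau d) = h d.
  case: (boolP (d \in codom dt)) => [/codomP[i ->]|/tau_id -> //].
  by rewrite tau_dt; apply: dt_trans.
have hsig d : h (sigma d) = h d by rewrite -[in RHS]hts htau.
pose hV v := [exists d, (tail d == v) && h d].
have hVE d : h d = hV (tail d).
  apply/idP/existsP => [hd|[x /andP[/eqP /(sigma_trans hsig) <- //]]].
  by exists d; rewrite eqxx.
by move=> x y; rewrite !hVE; apply: G_conn => d; rewrite -!hVE hrev.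
Qed.

(** The sum telescopes around [v] except where [tau] breaks the rotation. Thus the terminal [t i]
    lies between the dual terminals [i] and [th i], and this is how a cut remembers the ends of a
    path. *)
Lemma vertex_coboundary (W : D -> 'F_2) v : (forall d, W (psi d) = W d) ->
  \sum_(d | tail d == v) (W d + W (rev d)) = \sum_(i | t i == v) (W (dt i) + W (dt (th i))).
Proof.
move=> Wpsi; transitivity (\sum_(d | tail d == v) (W d + W (tau d))).
  rewrite !big_split /=; congr (_ + _); rewrite [RHS](reindex_inj (@perm_inj _ sigma)).
  by apply: eq_big => [d|d _]; rewrite ?tail_sigma // -[LHS]Wpsi psi_rev.
case: (pickP (fun i => t i == v)) => [i /eqP iv|noi].
  rewrite (bigD1 (dt i)) ?tail_dt ?iv //= [RHS](bigD1 i) ?iv //= tau_dt.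
  rewrite !big1 // => [j /andP[/eqP jv ij]|d /andP[/eqP dv di]].
    by move: ij; rewrite (t_inj (etrans jv (esym iv))) eqxx.
  rewrite tau_id ?addF2K //; apply: contra di => /codomP[j dj].
  by move: dv; rewrite dj tail_dt -iv => /t_inj ->.
rewrite [RHS]big_pred0 // big1 // => d /eqP dv; rewrite tau_id ?addF2K //.
by apply/codomP => -[i di]; move: (noi i); rewrite -dv di tail_dt eqxx.
Qed.

Definition face := {d | froot psi d == d}.

Lemma face_ofP d : froot psi (froot psi d) == froot psi d.
Proof. by apply/eqP/root_root; exact/fconnect_sym/perm_inj. Qed.

Definition face_of d : face := exist _ (froot psi d) (face_ofP d).

Lemma face_of_val (w : face) : face_of (val w) = w.
Proof. by apply/val_inj/eqP; exact: (valP w). Qed.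

Lemma face_of_eq d d' : (face_of d == face_of d') = fconnect psi d d'.
Proof. by rewrite -val_eqE /= root_connect //; exact/fconnect_sym/perm_inj. Qed.

Lemma face_of_psi d : face_of (psi d) = face_of d.
Proof.
by apply/eqP; rewrite face_of_eq fconnect_sym ?fconnect1 //; exact: perm_inj.
Qed.

Lemma psi_invariant_root (T : Type) (W : D -> T) : (forall d, W (psi d) = W d) ->
  forall d, W (froot psi d) = W d.
Proof.
move=> Wpsi d; have /iter_findex <- := connect_root (frel psi) d.
by elim: (findex _ _ _) => //= n; rewrite Wpsi.
Qed.

Hypothesis euler : (2 * #|{: face}| + 2 * #|V| = #|D| + 2 + 2 * k)%N.

(* Planar duality over F_2: by Euler's formula the coboundaries of the dual
   vertices fill the whole space of chains closed away from the terminals. *)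
Lemma closed_chain_coboundary (J : D -> 'F_2) :
  (forall d, J (rev d) = J d) ->
  (forall v, v \notin codom t -> \sum_(d | tail d == v) J d = 0) ->
  exists2 W : D -> 'F_2, forall d, W (psi d) = W d & forall d, J d = W d + W (rev d).
Proof.
move=> Jrev Jcl; pose E := {d : D | oriented rev d}.
(* The rows of [M] are the coboundaries of faces, those of [N] the coboundaries of vertices.
   Terminal rows of [N] are set to zero because [J] need not be closed there. *)
pose M (w : face) (e : E) : 'F_2 := (face_of (val e) == w)%:R + (face_of (rev (val e)) == w)%:R.
pose N v (e : E) : 'F_2 :=
  (v \notin codom t)%:R * ((tail (val e) == v)%:R + (tail (rev (val e)) == v)%:R).
have sumd (A : finType) (w : A -> 'F_2) x : \sum_y w y * (x == y)%:R = w x.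
  rewrite (bigD1 x) //= eqxx mulr1 big1 ?addr0 // => y.
  by rewrite eq_sym => /negPf ->; rewrite mulr0.
have wM w e : \sum_x w x * M x e = w (face_of (val e)) + w (face_of (rev (val e))).
  rewrite -(sumd _ w (face_of (val e))) -(sumd _ w (face_of (rev (val e)))) -big_split /=.
  by apply: eq_bigr => x _; rewrite mulrDr.
have oriP (g : D -> 'F_2) : (forall d, g (rev d) = g d) -> (forall e : E, g (val e) = 0) ->
    forall d, g d = 0.
  move=> gs g0 d; case: (boolP (oriented rev d)) => od; first exact: (g0 (exist _ d od)).
  rewrite -gs; move: od; rewrite -(oriented_rev revK rev_neq) => od.
  exact: (g0 (exist _ (rev d) od)).
have sumN (j : D -> 'F_2) v : (forall d, j (rev d) = j d) ->
    \sum_(e : E) j (val e) * N v e = (v \notin codom t)%:R * \sum_(d | tail d == v) j d.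
  move=> js; rewrite mulr_sumr [RHS]big_mkcond (sum_oriented revK rev_neq).
  apply: eq_bigr => e _; rewrite js /N.
  by case: (_ == v); case: (_ == v); rewrite ?mulr1 ?mulr0 ?addr0 ?add0r ?mulr0 //;
     rewrite ?mulrDr ?mulr1 //; ring.
(* One face suffices for [P], as only constants have zero coboundary; [Q] consists of the [k]
   terminals with zero rows. Euler's formula provides the required [1 + k]. *)
have [|||||w jw] :=
  @row_space_of_kernel _ face V E M N [set face_of (dt i0)] [set t i | i : 'I_k] _ _ _ _ (J \o val).
- move=> x v; rewrite (sumN (fun d => (face_of d == x)%:R + (face_of (rev d) == x)%:R)); last first.
    by move=> d; rewrite revK addrC.
  rewrite (@vertex_coboundary (fun d => (face_of d == x)%:R)) => [|d]; last by rewrite face_of_psi.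
  case: (boolP (v \in codom t)) => vt; first by rewrite mul0r.
  rewrite big_pred0 ?mulr0 // => i; apply/eqP => iv; move: vt; rewrite -iv.
  by rewrite codom_f.
- move=> w wK w0 x; rewrite -(face_of_val x).
  have wrev d : w (face_of d) + w (face_of (rev d)) = 0.
    apply: (oriP (fun d => w (face_of d) + w (face_of (rev d)))) => [c|e].
      by rewrite revK addrC.
    by rewrite -wM.
  have := @dual_connected (fun d => w (face_of d) == 0) _ _ (dt i0) (val x).
  rewrite w0 ?inE // eqxx => H; apply/eqP; rewrite -H // => d; first by rewrite face_of_psi.
  by rewrite (addF2_eq0 (wrev d)).
- move=> w wK w0.
  pose h v := (v \notin codom t)%:R * w v.
  have hK e : \sum_x w x * N x e = h (tail (val e)) + h (tail (rev (val e))).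
    rewrite -(sumd _ h (tail (val e))) -(sumd _ h (tail (rev (val e)))) -big_split /=.
    by apply: eq_bigr => x _; rewrite /h /N; ring.
  have hrev d : h (tail d) + h (tail (rev d)) = 0.
    apply: (oriP (fun d => h (tail d) + h (tail (rev d)))) => [c|e].
      by rewrite revK addrC.
    by rewrite -hK.
  move=> x; have := @G_conn (fun v => h v == 0) _ (t i0) x.
  have -> : h (t i0) = 0 by rewrite /h codom_f mul0r.
  rewrite eqxx => H.
  have /eqP : h x == 0 by rewrite -H // => d; rewrite (addF2_eq0 (hrev d)).
  rewrite /h; case: (boolP (x \in codom t)) => [/codomP[i ->] _|_]; last by rewrite mul1r.
  by apply: w0; exact: imset_f.
- rewrite cards1 card_imset // card_ord; move: euler.
  have arith a b c : (2 * a + 2 * b = 2 * c + 2 + 2 * k -> c + 1 + k <= a + b)%N by lia.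
  rewrite (card_oriented revK rev_neq) => /arith; exact.
- move=> v; rewrite (sumN J) //.
  by case: (boolP (v \in codom t)) => [|/Jcl ->]; rewrite ?mul0r ?mulr0.
exists (fun d => w (face_of d)) => [d|d]; first by rewrite face_of_psi.
apply: addF2_eq0; apply: (oriP (fun d => J d + (w (face_of d) + w (face_of (rev d))))) => [c|e].
  by rewrite Jrev revK; congr (_ + _); rewrite addrC.
by rewrite -wM -(jw e) addF2K.
Qed.

End PlaneDual.

(** * Comparing and counting orbits *)

Lemma fconnect_porbit (T : finType) (s : {perm T}) x y :
  fconnect s x y = (y \in porbit s x).
Proof.
apply/idP/porbitP => [/iter_findex <-|[i ->]]; first by exists (findex s x y); rewrite permX.
by rewrite permX fconnect_iter.
Qed.

Lemma fcard_leq (T T' : finType) (f : T -> T) (g : T' -> T') (h : T -> T') :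
  injective f -> injective g ->
  (forall x y, fconnect g (h x) (h y) -> fconnect f x y) ->
  (fcard f predT <= fcard g predT)%N.
Proof.
move=> f_inj g_inj hP; have fs := fconnect_sym f_inj; have gs := fconnect_sym g_inj.
have hinj : {in predI (froots f) predT &, injective (fun x => froot g (h x))}.
  move=> x y; rewrite !inE !andbT => /eqP <- /eqP <- /(fingraph.rootP gs) hxy.
  rewrite -[LHS](root_root fs) -[RHS](root_root fs); apply/(fingraph.rootP fs); exact: hP.
rewrite /n_comp_mem -(card_in_image hinj); apply/subset_leq_card/fintype.subsetP.
by move=> _ /fintype.imageP[x _ ->]; rewrite !inE andbT (roots_root gs).
Qed.

Lemma fcard_porbits (T : finType) (s : {perm T}) : fcard s predT = #|porbits s|.
Proof.
have ss := fconnect_sym (@perm_inj _ s).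
have pinj : {in predI (froots s) predT &, injective (porbit s)}.
  move=> x y; rewrite !inE !andbT => /eqP <- /eqP <- E.
  rewrite -[LHS](root_root ss) -[RHS](root_root ss); apply/(fingraph.rootP ss).
  by rewrite fconnect_porbit E porbit_id.
rewrite /n_comp_mem -(card_in_imset pinj); apply: eq_card => X.
apply/imsetP/imsetP => -[x _ ->]; first by exists x.
exists (froot s x).
  by rewrite !inE andbT (roots_root ss).
by apply/eqP; rewrite eq_porbit_mem -fconnect_porbit ss connect_root.
Qed.

Lemma dart_revK (V : finType) (e : rel V) : involutive (@dart_rev V e).
Proof. by move=> p; apply: val_inj; rewrite /= -surjective_pairing. Qed.

Lemma face_perm_inj (V : finType) (e : rel V) (s : {perm dart e}) : injective (face_perm s).
Proof. exact: inj_comp (@perm_inj _ s) (inv_inj (@dart_revK V e)). Qed.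

(** * The dual network *)

Section DualNetwork.
Variables (D : finType) (rev : D -> D) (psi : {perm D}).
Hypotheses (revK : involutive rev) (rev_neq : forall d, rev d != d).

(* The dual graph with every edge subdivided into three, which makes it simple:
   the darts d and rev d are the two inner vertices of the path dual to the edge of d. *)
Definition dual_vertex : finType := (face psi + D)%type.

(** The path dual to [d] runs through [face_of psi d], [d], [rev d], [face_of psi (rev d)]. A single
    inner vertex would turn a dual loop into a double edge. *)
Definition dual_edge (x y : dual_vertex) : bool :=
  match x, y with
  | inl w, inr d => w == face_of psi d
  | inr d, inl w => w == face_of psi d
  | inr d, inr d' => d' == rev d
  | _, _ => false
  end.

(** The dart of G crossed by a directed edge of the dual: all three edges of the path from the face
    of [d] to the face of [rev d] have base [d]. The value on two faces is a dummy. *)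
Definition dual_base (x y : dual_vertex) : D :=
  match x, y with
  | inr d, inr _ => d
  | inl _, inr d => d
  | inr d, inl _ => rev d
  | inl w, inl _ => val w
  end.

Lemma dual_edge_sym : symmetric dual_edge.
Proof. by move=> [w|d] [w'|d'] //=; apply/eqP/eqP => ->; rewrite revK. Qed.

Lemma dual_edge_irr : irreflexive dual_edge.
Proof. by move=> [w|d] //=; rewrite eq_sym (negPf (rev_neq d)). Qed.

Lemma dual_base_rev x y : dual_edge x y -> dual_base y x = rev (dual_base x y).
Proof. by move: x y => [w|d] [w'|d'] //=; rewrite ?revK // => /eqP. Qed.

Hypothesis dual_conn : forall h : D -> bool,
  (forall d, h (psi d) = h d) -> (forall d, h (rev d) = h d) -> forall x y, h x = h y.

Lemma dual_network_connected x y : connect dual_edge x y.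
Proof.
have sc := sym_connect_sym dual_edge_sym.
have tofaces z : exists d, connect dual_edge (inr d) z.
  case: z => [w|d]; last by exists d.
  by exists (val w); apply: connect1; rewrite /= face_of_val.
have toface d : connect dual_edge (inr d) (inl (face_of psi d)) by apply: connect1 => /=.
have [d dx] := tofaces x; have [d' dy] := tofaces y.
have dd' : connect dual_edge (inr d) (inr d').
  rewrite -(@dual_conn (fun z => connect dual_edge (inr d) (inr z)) _ _ d d') ?connect0 // => z.
    apply/esym/same_connect_r => //; rewrite sc; apply: connect_trans (toface _) _.
    by rewrite sc face_of_psi toface.
  by apply/esym/same_connect_r => //; apply: connect1 => /=.
by rewrite sc in dx; apply: connect_trans dx (connect_trans dd' dy).
Qed.

(** * Rotation and faces of the subdivided dual *)

Local Notation dual_dart := (dart dual_edge).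
Local Notation code := (D + D + D)%type.

Lemma spoke_out_dartP d : dartP dual_edge (inl (face_of psi d) : dual_vertex, inr d : dual_vertex).
Proof. by rewrite /dartP /= eqxx. Qed.
Lemma spoke_in_dartP d : dartP dual_edge (inr d : dual_vertex, inl (face_of psi d) : dual_vertex).
Proof. by rewrite /dartP /= eqxx. Qed.
Lemma middle_dartP d : dartP dual_edge (inr d : dual_vertex, inr (rev d) : dual_vertex).
Proof. by rewrite /dartP /= revK !eqxx. Qed.

Definition code_dart (z : code) : dual_dart :=
  match z with
  | inl (inl d) => exist (fun p => is_true (dartP dual_edge p)) _ (spoke_out_dartP d)
  | inl (inr d) => exist (fun p => is_true (dartP dual_edge p)) _ (spoke_in_dartP d)
  | inr d => exist (fun p => is_true (dartP dual_edge p)) _ (middle_dartP d)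
  end.

Definition dart_code (p : dual_dart) : code :=
  match val p with
  | (inl _, inr d) => inl (inl d)
  | (inr d, inl _) => inl (inr d)
  | (inr d, inr _) => inr d
  | (inl w, inl _) => inr (val w)
  end.

Lemma code_dartK : cancel code_dart dart_code.
Proof. by case=> [[d|d]|d]. Qed.

Lemma dart_codeK : cancel dart_code code_dart.
Proof.
move=> [[[w|d] [w'|d']] p]; apply: val_inj; rewrite /dart_code //=; move: p; rewrite /dartP /=.
- by case/andP => /eqP ->.
- by case/andP => /eqP ->.
- by case/andP => /eqP ->.
Qed.

(** The face permutation [psi] of the split map serves as rotation around the dual vertices; at a
    subdivision vertex the two darts are exchanged. *)
Definition code_rotation (z : code) : code :=
  match z with
  | inl (inl d) => inl (inl (psi d))
  | inl (inr d) => inr d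
  | inr d => inl (inr d)
  end.

Lemma dual_rotation_inj : injective (code_dart \o code_rotation \o dart_code).
Proof.
apply: inj_comp (can_inj dart_codeK); apply: inj_comp (can_inj code_dartK) _.
by move=> [[d|d]|d] [[d'|d']|d'] // [] => [/perm_inj||] ->.
Qed.

Definition dual_rotation : {perm dual_dart} := perm dual_rotation_inj.

Lemma dual_rotationE z : dual_rotation (code_dart z) = code_dart (code_rotation z).
Proof. by rewrite permE /= code_dartK. Qed.

Definition code_face (z : code) : code :=
  match z with
  | inl (inl d) => inr d
  | inl (inr d) => inl (inl (psi d))
  | inr d => inl (inr (rev d))
  end.

Lemma dual_face_permE z : face_perm dual_rotation (code_dart z) = code_dart (code_face z).
Proof.
have revE : dart_rev (code_dart z) = code_dart (match z with
    inl (inl d) => inl (inr d) | inl (inr d) => inl (inl d) | inr d => inr (rev d) end).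
  by case: z => [[d|d]|d]; apply: val_inj => //=; rewrite revK.
by rewrite /face_perm revE dual_rotationE; case: {revE}z => [[d|d]|d].
Qed.

Lemma dual_rotation_system : rotation_system dual_rotation.
Proof.
have rs := fconnect_sym (@perm_inj _ dual_rotation).
split=> [p|p p'].
  rewrite -(dart_codeK p) dual_rotationE; case: (dart_code p) => [[d|d]|d] //.
  by rewrite /dart_tail /= face_of_psi.
rewrite -(dart_codeK p) -(dart_codeK p') /dart_tail.
have rotS z : fconnect dual_rotation (code_dart z) (code_dart (code_rotation z)).
  by rewrite -dual_rotationE fconnect1.
have stepA d d' : fconnect psi d d' ->
    fconnect dual_rotation (code_dart (inl (inl d))) (code_dart (inl (inl d'))).
  move=> /iter_findex <-; elim: (findex _ _ _) => [|n IH]; first exact: connect0.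
  exact: connect_trans IH (rotS (inl (inl _))).
have stepB d : fconnect dual_rotation (code_dart (inl (inr d))) (code_dart (inr d)).
  exact: (rotS (inl (inr d))).
case: (dart_code p) (dart_code p') => [[d|d]|d] [[d'|d']|d'] // E.
- by apply: stepA; move: E => [/eqP]; rewrite -face_of_eq -val_eqE.
- by move: E => [->].
- by move: E => [->]; exact: stepB.
- by move: E => [->]; rewrite rs; exact: stepB.
- by move: E => [->].
Qed.

Lemma card_dual_dart : #|{: dual_dart}| = (3 * #|D|)%N.
Proof.
have -> : #|{: dual_dart}| = #|{: code}|.
  by apply: bij_eq_card; exists code_dart; [exact: dart_codeK | exact: code_dartK].
by rewrite !card_sum; lia.
Qed.

(** Constant along each run [inl (inl d)], [inr d], [inl (inr (rev d))] of [code_face], after which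
    the run of [psi (rev d)] begins. *)
Definition code_origin (z : code) : D :=
  match z with
  | inl (inl d) => d
  | inl (inr d) => rev d
  | inr d => d
  end.

Local Notation phi := (face_perm dual_rotation).

(** Three steps of the new face permutation make one step of [psi \o rev], so subdivision does not
    change the faces. *)
Lemma dual_face_connect z z' :
  fconnect (psi \o rev) (code_origin z) (code_origin z') =
  fconnect (face_perm dual_rotation) (code_dart z) (code_dart z').
Proof.
have rinj : injective (psi \o rev) by apply: inj_comp (@perm_inj _ psi) (inv_inj revK).
have finj : injective phi := @face_perm_inj _ _ dual_rotation.
have rs := fconnect_sym rinj; have fs := fconnect_sym finj.
have faceS y : fconnect phi (code_dart y) (code_dart (code_face y)).
  by rewrite -dual_face_permE; exact: fconnect1.
have AC d : fconnect phi (code_dart (inl (inl d))) (code_dart (inr d)).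
  exact: (faceS (inl (inl d))).
have CB d : fconnect phi (code_dart (inr d)) (code_dart (inl (inr (rev d)))).
  exact: (faceS (inr d)).
have BA d : fconnect phi (code_dart (inl (inr d))) (code_dart (inl (inl (psi d)))).
  exact: (faceS (inl (inr d))).
have toA y : fconnect phi (code_dart (inl (inl (code_origin y)))) (code_dart y).
  case: y => [[d|d]|d]; [exact: connect0 | | exact: AC].
  by apply: connect_trans (AC _) _; have := CB (rev d); rewrite revK.
apply/idP/idP.
  have zA : fconnect phi (code_dart z) (code_dart (inl (inl (code_origin z)))).
    by rewrite fs toA.
  move=> zz'; apply: connect_trans zA (connect_trans _ (toA z')).
  rewrite -(iter_findex zz'); elim: (findex _ _ _) => [|n IH]; first exact: connect0.
  rewrite iterS; apply: connect_trans IH _.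
  set d := iter _ _ _; apply: connect_trans (AC d) (connect_trans (CB d) _).
  exact: BA.
move=> /iter_findex E.
have {E} <- : dart_code (iter (findex phi (code_dart z) (code_dart z')) phi (code_dart z)) = z'.
  by rewrite E code_dartK.
elim: (findex _ _ _) => [|n IH]; first by rewrite code_dartK.
apply: connect_trans IH _; rewrite iterS; set p := iter _ _ _.
rewrite -(dart_codeK p) dual_face_permE !code_dartK.
case: (dart_code p) => [[d|d]|d] //=; last by rewrite revK.
by rewrite -[X in psi X]revK; exact: fconnect1.
Qed.

(** Subdivision adds [#|D|] vertices and equally many edges, which keeps the Euler
    characteristic. *)
Lemma dual_genus0 :
  (2 * #|{: face psi}| + 2 * fcard (psi \o rev) predT = #|D| + 4)%N ->
  genus0 dual_rotation.
Proof.
have rinj : injective (psi \o rev) by apply: inj_comp (@perm_inj _ psi) (inv_inj revK).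
have finj := @face_perm_inj _ _ dual_rotation.
have -> : fcard (psi \o rev) predT = fcard (face_perm dual_rotation) predT.
  apply/eqP; rewrite eqn_leq; apply/andP; split.
    apply: (@fcard_leq _ _ _ _ (fun d => code_dart (inl (inl d)))) => // d d'.
    by rewrite -dual_face_connect.
  apply: (@fcard_leq _ _ _ _ (fun p => code_origin (dart_code p))) => // p p'.
  by rewrite dual_face_connect !dart_codeK.
have arith a b c : (2 * a + 2 * b = c + 4 -> 2 * (a + c) + 2 * b = 3 * c + 4)%N by lia.
by rewrite /genus0 card_dual_dart card_sum => /arith.
Qed.

Lemma dual_planar (k : nat) (dt : 'I_k -> D) (i0 : 'I_k) :
  (2 * #|{: face psi}| + 2 * fcard (psi \o rev) predT = #|D| + 4)%N ->
  (forall i, fconnect (psi \o rev) (dt i0) (dt i)) ->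
  planar_terminals_one_face dual_edge (fun i => inl (face_of psi (dt i)) : dual_vertex).
Proof.
move=> euler dtf; exists dual_rotation; split; [exact: dual_rotation_system | exact: dual_genus0 |].
exists (code_dart (inl (inl (dt i0)))) => i; exists (code_dart (inl (inl (dt i)))); split => //.
by rewrite -dual_face_connect; exact: dtf.
Qed.

End DualNetwork.

(** * Lists of dual edges as chains over F_2 *)

Section Chains.
Variables (V D : finType) (rev : D -> D) (tail : D -> V) (psi : {perm D}).
Variables (k : nat) (t : 'I_k -> V) (dt : 'I_k -> D) (th : 'I_k -> 'I_k).
Local Notation dv := (dual_vertex psi).
Local Notation de := (@dual_edge D rev psi).
Local Notation base := (@dual_base D rev psi).

(** A directed edge of the dual is read as the edge of G that it crosses, so a list of dual edges
    can stand for a walk in G. *)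
Definition edge_source (z : dv * dv) := tail (base z.1 z.2).
Definition edge_target (z : dv * dv) := tail (rev (base z.1 z.2)).
Definition dual_terminal (i : 'I_k) : dv := inl (face_of psi (dt i)).

Definition crossings (l : seq (dv * dv)) (x y : dv) : 'F_2 :=
  \sum_(z <- l) ((z == (x, y))%:R + (z == (y, x))%:R).

Definition chain_boundary (l : seq (dv * dv)) (v : V) : 'F_2 :=
  \sum_(z <- l) ((edge_source z == v)%:R + (edge_target z == v)%:R).

Hypotheses (revK : involutive rev) (t_inj : injective t).
Hypothesis closed_cob : forall J : D -> 'F_2,
  (forall d, J (rev d) = J d) ->
  (forall v, v \notin codom t -> \sum_(d | tail d == v) J d = 0) ->
  exists2 W : D -> 'F_2, forall d, W (psi d) = W d & forall d, J d = W d + W (rev d).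
Hypothesis vertex_cob : forall (W : D -> 'F_2) v, (forall d, W (psi d) = W d) ->
  \sum_(d | tail d == v) (W d + W (rev d)) = \sum_(i | t i == v) (W (dt i) + W (dt (th i))).

Lemma crossings_sym l x y : crossings l x y = crossings l y x.
Proof. by apply: eq_bigr => z _; rewrite addrC. Qed.

Let inl_eq (a b : face psi) : ((inl a : dv) == inl b) = (a == b).
Proof. by apply/eqP/eqP => [[]|->]. Qed.
Let inr_eq (a b : D) : ((inr a : dv) == inr b) = (a == b).
Proof. by apply/eqP/eqP => [[]|->]. Qed.

Let inl_inr (a : face psi) (b : D) : ((inl a : dv) == inr b) = false.
Proof. by apply/eqP. Qed.
Let inr_inl (a : face psi) (b : D) : ((inr b : dv) == inl a) = false.
Proof. by apply/eqP. Qed.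

(** The three pieces of the path dual to [d] stand for one edge of G, so their uses add up to the
    uses of that edge. *)
Lemma crossings_dual_path (z : dv * dv) d : de z.1 z.2 ->
  let one x y := (z == (x, y))%:R + (z == (y, x))%:R : 'F_2 in
  one (inl (face_of psi d)) (inr d) + one (inr d) (inr (rev d))
    + one (inl (face_of psi (rev d))) (inr (rev d)) =
  (base z.1 z.2 == d)%:R + (base z.1 z.2 == rev d)%:R.
Proof.
have fid a b : (face_of psi a == face_of psi b) && (a == b) = (a == b).
  by apply: andb_idl => /eqP ->.
have revE a : (rev a == d) = (a == rev d) by apply/eqP/eqP => [<-|->]; rewrite revK.
case: z => [[w|a] [w'|b]] //=; rewrite !xpair_eqE ?inl_eq ?inr_eq /= => /eqP E.
- by rewrite {w}E !addr0 !fid.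
- rewrite {w'}E !inl_inr !andbF !addr0 !add0r revE (inj_eq (inv_inj revK)) addrC.
  by rewrite ![(a == _) && _]andbC !fid.
- by rewrite {b}E (inj_eq (inv_inj revK)) revE !inr_inl !andbb ?andbF !addr0 ?add0r.
Qed.

Lemma closed_list_coboundary (l : seq (dv * dv)) :
  {in l, forall z, de z.1 z.2} -> (forall v, v \notin codom t -> chain_boundary l v = 0) ->
  exists W : dv -> 'F_2, (forall x y, de x y -> W x + W y = crossings l x y) /\
    (forall i, W (dual_terminal i) + W (dual_terminal (th i)) = chain_boundary l (t i)).
Proof.
move=> le lcl.
pose J d := \sum_(z <- l) ((base z.1 z.2 == d)%:R + (base z.1 z.2 == rev d)%:R) : 'F_2.
have JE d : J d = crossings l (inl (face_of psi d)) (inr d) + crossings l (inr d) (inr (rev d))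
    + crossings l (inl (face_of psi (rev d))) (inr (rev d)).
  rewrite /crossings -!big_split /=; apply: eq_big_seq => z zl.
  by rewrite -(crossings_dual_path d (le _ zl)).
have Jrev d : J (rev d) = J d by apply: eq_bigr => z _; rewrite revK addrC.
have Jbd v : \sum_(d | tail d == v) J d = chain_boundary l v.
  rewrite exchange_big; apply: eq_bigr => z _; rewrite big_split /=; congr (_ + _).
    by rewrite big_mkcond (bigD1 (base z.1 z.2)) //= eqxx big1 ?addr0 => [|d /negPf]; 
      [rewrite /edge_source; case: (_ == v) | rewrite eq_sym => ->; case: ifP].
  rewrite big_mkcond (bigD1 (rev (base z.1 z.2))) //= revK eqxx big1 ?addr0.
    by rewrite /edge_target; case: (_ == v).
  move=> d dz; have -> : (base z.1 z.2 == rev d) = false; last by case: ifP.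
  by apply: contraNF dz => /eqP ->; rewrite revK.
have [|W0 Wpsi WJ] := closed_cob Jrev; first by move=> v vt; rewrite Jbd lcl.
(* The potential on faces extends to the inner vertices so that each spoke jumps exactly when it is
   used; the middle piece then comes out right because [J d] is the sum over the three pieces. *)
pose W (x : dv) := match x with
  | inl w => W0 (val w)
  | inr d => W0 d + crossings l (inl (face_of psi d)) (inr d) end.
have Wface d : W (inl (face_of psi d)) = W0 d by rewrite /= (psi_invariant_root Wpsi).
exists W; split=> [[w|a] [w'|b]|i] //.
- move=> /eqP ->; rewrite Wface /= addrA addF2K add0r //.
- by move=> /eqP ->; rewrite Wface addrC /= addrA addF2K add0r crossings_sym.
- move=> /eqP ->; rewrite /= addrACA -WJ JE.
  set a1 := crossings _ _ _; set a2 := crossings _ _ _; set a3 := crossings _ _ _.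
  rewrite [LHS](_ : _ = a2 + (a1 + a1) + (a3 + a3)); last by ring.
  by rewrite !addF2K !addr0.
rewrite !Wface -Jbd (eq_bigr (fun d => W0 d + W0 (rev d))) => [|d _]; last by rewrite WJ.
by rewrite vertex_cob // (big_pred1 i) // => j; rewrite /= (inj_eq t_inj).
Qed.

Lemma terminal_coboundary (W : dv -> 'F_2) v :
  \sum_(d | tail d == v) (W (inl (face_of psi d)) + W (inl (face_of psi (rev d)))) =
  \sum_(i | t i == v) (W (dual_terminal i) + W (dual_terminal (th i))).
Proof.
by rewrite (vertex_cob (W := fun d => W (inl (face_of psi d)))) // => d; rewrite face_of_psi.
Qed.

End Chains.

(** * Comparing infima, and sums over cuts *)

Lemma inf_eq_dominated (A B : classical_sets.set R) :
  (exists x, A x) -> (forall x, A x -> 0 <= x) -> (forall x, B x -> 0 <= x) ->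
  (forall x, A x -> exists2 y, B y & y <= x) -> (forall x, B x -> exists2 y, A y & y <= x) ->
  inf A = inf B.
Proof.
move=> [a0 Aa0] A0 B0 AB BA; have [b0 Bb0 _] := AB _ Aa0.
apply/eqP; rewrite eq_le; apply/andP; split; apply: lb_le_inf.
- by exists b0.
- by move=> x /BA[y Ay yx]; apply: le_trans yx; apply: ge_inf Ay; exists 0.
- by exists a0.
- by move=> x /AB[y By yx]; apply: le_trans yx; apply: ge_inf By; exists 0.
Qed.

Lemma sum_symmetric_pairs_F2 (T : finType) (f : T -> T -> 'F_2) :
  (forall x y, f x y = f y x) -> (forall x, f x x = 0) -> \sum_x \sum_y f x y = 0.
Proof.
move=> fs f0; rewrite pair_big /= (bigID (fun p => (enum_rank p.1 < enum_rank p.2)%N)) /=.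
rewrite [X in _ + X](bigID (fun p => p.1 == p.2)) /=.
rewrite [X in _ + (X + _)]big1 ?add0r => [|p /andP[_ /eqP ->]]; last exact: f0.
have swapI : injective (fun p : T * T => (p.2, p.1)) by move=> [a b] [c d] [-> ->].
rewrite [X in _ + X](reindex_inj swapI) /= [X in _ + X](eq_bigl
  (fun p => (enum_rank p.1 < enum_rank p.2)%N)) => [|p]; last first.
  by rewrite -leqNgt ltn_neqAle andbC eq_sym -(inj_eq enum_rank_inj).
by rewrite [X in _ + X](eq_bigr (fun p => f p.1 p.2)) ?addF2K // => p _; rewrite fs.
Qed.

Section CutSums.
Variables (T : finType) (e : rel T).
Hypothesis e_sym : symmetric e.
Implicit Types (f : T -> T -> R) (W : {set T}).

Lemma cut_sumE f W :
  \sum_(x in W) \sum_(y in ~: W | e x y) f x y =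
  \sum_x \sum_(y | e x y) ((x \in W) && (y \notin W))%:R * f x y.
Proof.
rewrite big_mkcond; apply: eq_bigr => x _; case: ifP => xW /=; last first.
  by rewrite big1 // => y _; rewrite mul0r.
rewrite big_mkcond [RHS]big_mkcond; apply: eq_bigr => y _; rewrite inE.
by case: (e x y); rewrite ?andbF // andbT; case: (y \in W); rewrite ?mul1r ?mul0r.
Qed.

(** A walk may use an edge in either direction; pairing the two directions turns a sum over ordered
    pairs into a sum over the edges of a cut. *)
Lemma cut_sum_both f W :
  \sum_(x in W) \sum_(y in ~: W | e x y) (f x y + f y x) =
  \sum_x \sum_(y | e x y) ((x \in W) != (y \in W))%:R * f x y.
Proof.
rewrite cut_sumE.
under eq_bigr do under eq_bigr do rewrite mulrDr.
under eq_bigr do rewrite big_split /=.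
rewrite big_split /= [X in _ + X](exchange_big_dep predT) //= -big_split /=.
apply: eq_bigr => x _; rewrite [X in _ + X](eq_bigl (e x)) => [|y]; last by rewrite e_sym.
rewrite -big_split /=; apply: eq_bigr => y _; rewrite -mulrDl -natrD.
by case: (x \in W); case: (y \in W).
Qed.

Lemma cut_sum_both_le f W : (forall x y, e x y -> 0 <= f x y) ->
  \sum_(x in W) \sum_(y in ~: W | e x y) (f x y + f y x) <= \sum_x \sum_(y | e x y) f x y.
Proof.
move=> f0; rewrite cut_sum_both; apply: ler_sum => x _; apply: ler_sum => y /f0 ?.
by case: (_ != _); rewrite ?mul1r ?mul0r.
Qed.

Lemma cut_sum_both_eq f W : (forall x y, e x y -> (x \in W) = (y \in W) -> f x y = 0) ->
  \sum_(x in W) \sum_(y in ~: W | e x y) (f x y + f y x) = \sum_x \sum_(y | e x y) f x y.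
Proof.
move=> f0; rewrite cut_sum_both; apply: eq_bigr => x _; apply: eq_bigr => y /f0.
by case: eqP => [-> ->//|_ _]; rewrite ?mulr0 ?mul1r.
Qed.

End CutSums.

Lemma sum_mem_count (T : eqType) (S : pzSemiRingType) (l : seq T) a :
  \sum_(z <- l) (z == a)%:R = (count_mem a l)%:R :> S.
Proof. by elim: l => [|z l IH]; rewrite ?big_nil // big_cons IH -natrD. Qed.

(** * Contraction along a minor of the dual *)

Section MinorOfDual.
Variables (V D : finType) (rev : D -> D) (tail : D -> V) (psi : {perm D}).
Variables (k : nat) (t : 'I_k -> V) (dt : 'I_k -> D) (th : 'I_k -> 'I_k).
Local Notation dv := (dual_vertex psi).
Local Notation de := (@dual_edge D rev psi).
Local Notation base := (@dual_base D rev psi).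
Local Notation source := (@edge_source V D rev tail psi).
Local Notation target := (@edge_target V D rev tail psi).
Local Notation dual_terminal := (dual_terminal psi dt).
Local Notation boundary := (@chain_boundary V D rev tail psi).

Hypotheses (revK : involutive rev) (rev_neq : forall d, rev d != d).
Hypothesis t_inj : injective t.
Hypothesis list_cob : forall l : seq (dv * dv),
  {in l, forall z, de z.1 z.2} -> (forall v, v \notin codom t -> boundary l v = 0) ->
  exists W : dv -> 'F_2, (forall x y, de x y -> W x + W y = crossings l x y) /\
    (forall i, W (dual_terminal i) + W (dual_terminal (th i)) = boundary l (t i)).
Hypothesis term_cob : forall (W : dv -> 'F_2) v,
  \sum_(d | tail d == v) (W (inl (face_of psi d)) + W (inl (face_of psi (rev d)))) =
  \sum_(i | t i == v) (W (dual_terminal i) + W (dual_terminal (th i))).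

Variables (VH : finType) (eH : rel VH) (cH : VH -> VH -> R) (tH : 'I_k -> VH).
Variables (phi : VH -> {set dv}) (g : VH -> VH -> dv * dv).
Hypotheses (eH_sym : symmetric eH) (cH_sym : forall x y, eH x y -> cH x y = cH y x).
Hypothesis cH_ge0 : forall x y, eH x y -> 0 <= cH x y.
Hypothesis phi_inj : forall u v x, x \in phi u -> x \in phi v -> u = v.
Hypothesis phi_conn : forall u x y, x \in phi u -> y \in phi u ->
  connect [rel a b | [&& de a b, a \in phi u & b \in phi u]] x y.
Hypothesis phi_tH : forall i, dual_terminal i \in phi (tH i).
Hypothesis g1 : forall u v, eH u v -> (g u v).1 \in phi u.
Hypothesis g2 : forall u v, eH u v -> (g u v).2 \in phi v.
Hypothesis g_de : forall u v, eH u v -> de (g u v).1 (g u v).2.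
Hypothesis g_sym : forall u v, eH u v -> g v u = ((g u v).2, (g u v).1).

(** An edge inside a branch set is contracted in the dual, hence deleted in G. *)
Definition inside (z : dv * dv) := [exists u, (z.1 \in phi u) && (z.2 \in phi u)].
Definition usable (z : dv * dv) := de z.1 z.2 && ~~ inside z.
(** A chosen edge has the weight of its edge of H. All others cost zero, which amounts to
    contracting them as far as lengths of walks are concerned. *)
Definition cost (z : dv * dv) : R := \sum_u \sum_(v | eH u v) (z == g u v)%:R * cH u v.

Fixpoint gwalk (x : V) (l : seq (dv * dv)) (y : V) : bool :=
  if l is z :: l' then [&& usable z, source z == x & gwalk (target z) l' y] else x == y.

(** For [i != j]: [S] is one of the two arcs into which [t i] and [t j] divide the cyclic order [th]
    of the dual terminals. *)
Definition separates (i j : 'I_k) (S : {set 'I_k}) :=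
  forall l, (l \in S)%:R + (th l \in S)%:R = (l == i)%:R + (l == j)%:R :> 'F_2.

Lemma source_swap x y : de x y -> source (y, x) = target (x, y).
Proof. by move=> exy; rewrite /edge_source /edge_target /= dual_base_rev. Qed.

Lemma target_swap x y : de x y -> target (y, x) = source (x, y).
Proof. by move=> exy; rewrite /edge_source /edge_target /= dual_base_rev // revK. Qed.

Lemma gwalk_usable x l y : gwalk x l y -> {in l, forall z, usable z}.
Proof.
elim: l x => //= z l IH x /and3P[uz _ /IH ul] z'; rewrite inE => /orP[/eqP -> //|]; exact: ul.
Qed.

Lemma gwalk_boundary x l y v : gwalk x l y -> boundary l v = (x == v)%:R + (y == v)%:R.
Proof.
rewrite /chain_boundary; elim: l x => [x /eqP ->|z l IH x /= /and3P[_ /eqP <- /IH E]].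
  by rewrite big_nil addF2K.
rewrite big_cons E; set a := _%:R; set b := _%:R; set c := _%:R.
by rewrite addrA -[a + b + b]addrA addF2K addr0.
Qed.

Lemma gwalk_cat x l y l' z : gwalk x l y -> gwalk y l' z -> gwalk x (l ++ l') z.
Proof.
elim: l x => [x /eqP -> //|a l IH x /= /and3P[-> -> /IH H] /H]; by rewrite !andTb.
Qed.

Lemma sum_cost l :
  \sum_(z <- l) cost z = \sum_u \sum_(v | eH u v) (count_mem (g u v) l)%:R * cH u v.
Proof.
rewrite exchange_big; apply: eq_bigr => u _; rewrite exchange_big; apply: eq_bigr => v _.
by rewrite -sum_mem_count mulr_suml.
Qed.

Lemma cost_ge0 z : 0 <= cost z.
Proof. by apply: sumr_ge0 => u _; apply: sumr_ge0 => v /cH_ge0 c0; rewrite mulr_ge0. Qed.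

(** No edge of [l] lies inside a branch set, so the potential from duality is constant on each
    branch set and defines a set of vertices of H. An edge of H in its cut has its chosen edge in
    [l] in one of the two directions, which gives the weight bound. *)
Lemma usable_list_cut (l : seq (dv * dv)) :
  {in l, forall z, usable z} -> (forall v, v \notin codom t -> boundary l v = 0) ->
  exists WH : {set VH},
    [/\ forall u v, eH u v ->
          (u \in WH)%:R + (v \in WH)%:R = crossings l (g u v).1 (g u v).2,
        forall i, (tH i \in WH)%:R + (tH (th i) \in WH)%:R = boundary l (t i) &
        cut_weight eH cH WH <= \sum_(z <- l) cost z].
Proof.
move=> lu lcl; have [|W [WE Wt]] := list_cob _ lcl; first by move=> z /lu /andP[].
have Wphi u x y : x \in phi u -> y \in phi u -> W x = W y.
  move=> xu yu; have /connectP[p] := phi_conn xu yu.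
  elim: p x xu => [x _ _ -> //|a p IH x xu /= /andP[/and3P[xa _ au] pp] yE].
  rewrite -(IH a) //; apply/addF2_eq0; rewrite WE // /crossings big_seq big1 // => z zl.
  have nz x' y' : x' \in phi u -> y' \in phi u -> z == (x', y') = false.
    move=> x'u y'u; apply/eqP => E; have /andP[_ /negP[]] := lu _ zl.
    by apply/existsP; exists u; rewrite E x'u.
  by rewrite !nz ?addr0.
pose WH := [set u | [exists x in phi u, W x != 0]].
have WHE u x : x \in phi u -> (u \in WH)%:R = W x.
  move=> xu; rewrite [RHS]F2_bool inE; congr (_ : bool)%:R.
  apply/existsP/idP => [[y /andP[yu Wy]]|Wx]; first by rewrite (Wphi u x y).
  by exists x; rewrite xu.
have WHe u v : eH u v -> (u \in WH)%:R + (v \in WH)%:R = crossings l (g u v).1 (g u v).2.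
  by move=> uv; rewrite (WHE _ _ (g1 uv)) (WHE _ _ (g2 uv)) WE ?g_de.
exists WH; split=> //.
  by move=> i; rewrite !(WHE _ _ (phi_tH _)).
rewrite sum_cost; pose f u v : R := (count_mem (g u v) l)%:R * cH u v.
have f0 u v : eH u v -> 0 <= f u v by move=> /cH_ge0 c0; rewrite mulr_ge0.
apply: le_trans (cut_sum_both_le eH_sym WH f0).
apply: ler_sum => u uW; apply: ler_sum => v /andP[]; rewrite inE => vW uv.
have vu : eH v u by rewrite eH_sym.
rewrite /f (cH_sym vu) -mulrDl -natrD ler_peMl ?cH_ge0 // (ler_nat _ 1).
have := WHe _ _ uv; rewrite uW (negPf vW) addr0 => cr.
have : (g u v \in l) || (g v u \in l).
  apply: contra_eqT cr; rewrite negb_or => /andP[nuv nvu].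
  rewrite /crossings big_seq big1 // => z zl; rewrite -surjective_pairing -g_sym //.
  have -> : (z == g u v) = false by apply: contraNF nuv => /eqP <-.
  have -> : (z == g v u) = false by apply: contraNF nvu => /eqP <-.
  by rewrite addr0.
by rewrite addn_gt0 -!has_count !has_pred1.
Qed.

Lemma gwalk_cut i j l : gwalk (t i) l (t j) ->
  exists WH : {set VH}, separates i j [set m | tH m \in WH] /\
    cut_weight eH cH WH <= \sum_(z <- l) cost z.
Proof.
move=> gw; have [||WH [_ WHt WHc]] := @usable_list_cut l.
- exact: gwalk_usable gw.
- move=> v vt; rewrite (gwalk_boundary _ gw).
  have nv m : (t m == v) = false by apply: contraNF vt => /eqP <-; exact: codom_f.
  by rewrite !nv addr0.
exists WH; split=> // m; rewrite !inE WHt (gwalk_boundary _ gw) !(inj_eq t_inj).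
by rewrite ![m == _]eq_sym.
Qed.

Lemma gwalk_source x l y z : gwalk x l y -> z \in l -> source z \in x :: map target l.
Proof.
elim: l x => //= a l IH x /and3P[_ /eqP ax /IH H]; rewrite !inE => /orP[/eqP ->|/H].
  by rewrite ax eqxx.
by rewrite inE => ->; rewrite orbT.
Qed.

(** A second use of an edge, in either direction, would revisit one of its ends. *)
Lemma count_simple_gwalk x l y z : gwalk x l y -> uniq (x :: map target l) ->
  (count_mem z l + count_mem (z.2, z.1) l <= 1)%N.
Proof.
elim: l x => //= a l IH x /and3P[ua /eqP ax gw] /andP[xn un]; have := IH _ gw un.
have an : a \notin l.
  by apply: contra xn => al; rewrite -{1}ax; exact: gwalk_source gw al.
have /andP[ea _] := ua; have {}ea : de a.1 a.2 by [].
have an' : (a.2, a.1) \notin l.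
  apply: contra xn => /(map_f target); rewrite target_swap // -surjective_pairing ax.
  by rewrite inE => ->; rewrite orbT.
have aa : (a.2, a.1) != a.
  apply: contraNneq xn => E; rewrite -{1}ax -{1}E source_swap // -surjective_pairing.
  by rewrite inE eqxx.
case: (eqVneq a z) => [<-|az] /=.
  by rewrite eq_sym (negPf aa) /= !(count_memPn _) // addn0.
case: (eqVneq a (z.2, z.1)) => [E|_] /=; last by rewrite !add0n.
rewrite add0n addnCA; have -> : z = (a.2, a.1) by rewrite E -surjective_pairing.
by rewrite /= -surjective_pairing !(count_memPn _).
Qed.

(** Dual vertices in no branch set lie outside for every [W]. Edges to them are never chosen edges,
    so crossing them costs nothing. *)
Definition covered (W : {set VH}) (x : dv) := [exists u in W, x \in phi u].

Lemma coveredE W u x : x \in phi u -> covered W x = (u \in W).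
Proof.
move=> xu; apply/existsP/idP => [[v /andP[vW xv]]|uW]; last by exists u; rewrite uW.
by rewrite (phi_inj xu xv).
Qed.

Definition crossed W (z : dv * dv) := de z.1 z.2 && (covered W z.1 != covered W z.2).

Lemma crossed_usable W z : crossed W z -> usable z.
Proof.
move=> /andP[ez Wz]; rewrite /usable ez; apply: contra Wz => /existsP[u /andP[z1 z2]].
by rewrite !(coveredE _ z1, coveredE _ z2).
Qed.

Definition step (P : pred (dv * dv)) : rel V :=
  [rel x y | [exists z, [&& P z, source z == x & target z == y]]].

Lemma step_sym (P : pred (dv * dv)) : {in P, forall z, de z.1 z.2} ->
  {in P, forall z, P (z.2, z.1)} -> symmetric (step P).
Proof.
move=> Pde Pswap; suff H x y : step P x y -> step P y x by move=> x y; apply/idP/idP; exact: H.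
move=> /existsP[z /and3P[Pz /eqP <- /eqP <-]]; apply/existsP; exists (z.2, z.1).
move: (source_swap (Pde _ Pz)) (target_swap (Pde _ Pz)); rewrite -surjective_pairing => -> ->.
by rewrite Pswap // !eqxx.
Qed.

Lemma path_gwalk (P : pred (dv * dv)) x p : {in P, forall z, usable z} -> path (step P) x p ->
  exists l, [/\ gwalk x l (last x p), map target l = p & {in l, forall z, P z}].
Proof.
move=> PU; elim: p x => [x _|y p IH x /= /andP[/existsP[z /and3P[zc zx /eqP zy]]]].
  by exists [::]; split=> //=; rewrite eqxx.
move=> /IH[l [gw lp lc]]; exists (z :: l); split=> /=; first by rewrite (PU _ zc) zx zy.
  by rewrite zy lp.
by move=> a; rewrite inE => /orP[/eqP ->|/lc].
Qed.

Lemma crossed_swap W : {in crossed W, forall z, crossed W (z.2, z.1)}.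
Proof. by move=> z /andP[ez Wz]; rewrite /crossed /= dual_edge_sym // ez eq_sym. Qed.

Definition crossing_step W := step (crossed W).

Lemma crossing_step_sym W : symmetric (crossing_step W).
Proof. by apply: step_sym (@crossed_swap W) => z /andP[]. Qed.

(** Parity: the edges of G dual to the cut form a chain with boundary [t i] plus [t j], and a
    boundary has even total on every component. *)
Lemma separating_cut_connect (W : {set VH}) i j : separates i j [set m | tH m \in W] ->
  connect (crossing_step W) (t i) (t j).
Proof.
move=> Wij; have ks := sym_connect_sym (crossing_step_sym W).
pose K := connect (crossing_step W) (t i).
pose w x : 'F_2 := (covered W x)%:R.
pose del d := w (inl (face_of psi d)) + w (inl (face_of psi (rev d))).
have del_step d : del d != 0 -> crossing_step W (tail d) (tail (rev d)).
  move=> dd; have : [|| crossed W (inl (face_of psi d), inr d),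
       crossed W (inr d, inr (rev d)) | crossed W (inr (rev d), inl (face_of psi (rev d)))].
    apply: contraNT dd; rewrite /crossed /= !eqxx !negb_or !negbK /del /w.
    by move=> /and3P[/eqP -> /eqP -> /eqP ->]; rewrite addF2K.
  by case/or3P => cz; apply/existsP; (eexists; apply/and3P; split;
      [exact: cz | |]); rewrite /edge_source /edge_target /= ?revK.
have Kdel d : del d != 0 -> K (tail d) = K (tail (rev d)).
  by move=> /del_step dd; exact: (same_connect_r ks (connect1 dd) (t i)).
(* An edge with nonzero [del] has both ends in [K] or neither, so its two darts cancel. *)
have sum0 : \sum_(d | K (tail d)) del d = 0.
  rewrite big_mkcond; apply: (sum_symmetric_F2 revK rev_neq) => d.
  have drev : del (rev d) = del d by rewrite /del revK addrC.
  by rewrite drev; case: (eqVneq (del d) 0) => [->|/Kdel ->//]; rewrite !if_same.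
have : \sum_(v | K v) \sum_(d | tail d == v) del d = 0.
  rewrite -[RHS]sum0 [RHS](partition_big tail K) //=; apply: eq_bigr => v Kv.
  by apply: eq_bigl => d; case: eqP => [->|]; rewrite ?Kv ?andbF.
under eq_bigr do rewrite term_cob.
have -> : \sum_(v | K v) \sum_(l | t l == v) (w (dual_terminal l) + w (dual_terminal (th l)))
   = \sum_(l | K (t l)) ((l == i)%:R + (l == j)%:R).
  rewrite [RHS](partition_big t K) //=; apply: eq_bigr => v Kv.
  apply: eq_big => [l|l _]; first by case: eqP => [->|]; rewrite ?Kv ?andbF.
  by rewrite -Wij !inE /w !(coveredE W (phi_tH _)).
have Ki : K (t i) by exact: connect0.
rewrite big_split /= (bigD1 i Ki) /= eqxx big1 ?addr0; last first.
  by move=> l /andP[_ /negPf ->].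
case: (boolP (K (t j))) => // Kj; rewrite big1 ?addr0 // => l Kl.
by case: eqP => // lj; rewrite -lj Kl in Kj.
Qed.

(** A walk across the cut without repeated vertices pays only for edges of H in the cut, and for
    each at most once. *)
Lemma cut_gwalk (W : {set VH}) i j : separates i j [set m | tH m \in W] ->
  exists l, gwalk (t i) l (t j) /\ \sum_(z <- l) cost z <= cut_weight eH cH W.
Proof.
move=> /separating_cut_connect /connectP[p0 pp0 lp0].
case: (shortenP pp0) lp0 => p pp up _ ->.
have [l [gw lp lc]] := path_gwalk (@crossed_usable W) pp; exists l; split=> //.
rewrite sum_cost -(cut_sum_both_eq (e := eH) eH_sym (W := W)); last first.
  move=> u v uv; rewrite -!(coveredE _ (g1 uv), coveredE _ (g2 uv)) => E.
  case: (boolP (g u v \in l)) => [/lc /andP[_]|/count_memPn ->]; last by rewrite mul0r.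
  by rewrite E eqxx.
apply: ler_sum => u uW; apply: ler_sum => v /andP[_ uv].
have vu : eH v u by rewrite eH_sym.
rewrite (cH_sym vu) -mulrDl -natrD ler_piMl ?cH_ge0 // (ler_nat _ _ 1) g_sym //.
by apply: count_simple_gwalk gw _; rewrite lp.
Qed.

Lemma separates_setC i j S : separates i j (~: S) <-> separates i j S.
Proof.
have E l : (l \in ~: S)%:R + (th l \in ~: S)%:R = (l \in S)%:R + (th l \in S)%:R :> 'F_2.
  by rewrite !inE; case: (l \in S); case: (th l \in S); apply/eqP.
by split=> ss l; have := ss l; rewrite E.
Qed.

Hypothesis th_trans : forall P : 'I_k -> bool,
  (forall l, P (th l) = P l) -> forall l m, P l = P m.

(** Whether [S] and [S'] agree at [l] is invariant under [th], which is transitive. *)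
Lemma separates_unique i j S S' : separates i j S -> separates i j S' -> S' = S \/ S' = ~: S.
Proof.
move=> sS sS'; pose P l := (l \in S) == (l \in S').
have Pth l : P (th l) = P l.
  have := etrans (sS l) (esym (sS' l)); rewrite /P.
  by case: (l \in S); case: (th l \in S); case: (l \in S'); case: (th l \in S') => // /eqP.
case: (boolP (P i)) => Pi; [left|right]; apply/setP => l; rewrite ?inE.
  by move: Pi; rewrite (th_trans Pth i l) => /eqP.
by move: Pi; rewrite (th_trans Pth i l) /P; case: (l \in S); case: (l \in S').
Qed.

Hypothesis tH_inj : injective tH.

(** Used twice: for the trivial minor the walks are those of G, for the sparsifier they are those of
    the contracted network. Both distances thereby become minimum cuts for the same [S]. *)
Lemma mincut_gwalk i j S : separates i j S ->
  mincut eH cH tH S =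
    inf [set r | exists l, gwalk (t i) l (t j) /\ r = \sum_(z <- l) cost z]%classic.
Proof.
move=> sS; have sepE W : [set m | tH m \in W] = S \/ [set m | tH m \in W] = ~: S <->
    separates i j [set m | tH m \in W].
  split=> [[->|->] //|sW]; last exact: separates_unique.
  exact/separates_setC.
apply: inf_eq_dominated.
- exists (cut_weight eH cH (tH @: S)), (tH @: S); split => //; left.
  by apply/setP => m; rewrite inE mem_imset.
- move=> _ [W [_ ->]]; apply: sumr_ge0 => u _; apply: sumr_ge0 => v /andP[_]; exact: cH_ge0.
- by move=> _ [l [_ ->]]; apply: sumr_ge0 => z _; exact: cost_ge0.
- move=> _ [W [/sepE /cut_gwalk[l [gw lW]] ->]].
  by exists (\sum_(z <- l) cost z) => //; exists l.
- move=> _ [l [/gwalk_cut[W [/sepE sW lW]] ->]].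
  by exists (cut_weight eH cH W) => //; exists W.
Qed.

Lemma gwalk_exists i j S : separates i j S -> exists l, gwalk (t i) l (t j).
Proof.
move=> sS; have [|l [gw _]] := @cut_gwalk (tH @: S) i j; last by exists l.
by rewrite (_ : [set _ | _] = S) //; apply/setP => m; rewrite inE mem_imset.
Qed.

(** * Contracting the free edges of G *)

Hypothesis H_conn : forall u v, connect eH u v.

Definition rep_edge (z : dv * dv) := [exists u, exists v, eH u v && (z == g u v)].
Definition free (z : dv * dv) := usable z && ~~ rep_edge z.

Lemma rep_edgeE u v : eH u v -> rep_edge (g u v).
Proof. by move=> uv; apply/existsP; exists u; apply/existsP; exists v; rewrite uv eqxx. Qed.

Lemma g_inj u v u' v' : eH u v -> eH u' v' -> g u v = g u' v' -> u = u' /\ v = v'.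
Proof.
move=> uv uv' E; split; [apply: (phi_inj (g1 uv))|apply: (phi_inj (g2 uv))]; rewrite E.
  exact: g1.
exact: g2.
Qed.

Lemma rep_edge_usable u v : eH u v -> u != v -> usable (g u v).
Proof.
move=> uv nuv; rewrite /usable g_de //; apply: contra nuv => /existsP[w /andP[w1 w2]].
by rewrite (phi_inj (g1 uv) w1) (phi_inj (g2 uv) w2).
Qed.

Lemma cost_rep_edge u v : eH u v -> cost (g u v) = cH u v.
Proof.
move=> uv; rewrite /cost (bigD1 u) //= (bigD1 v) //= eqxx mul1r.
rewrite !big1 ?addr0 // => [u' nu|v' /andP[uv' nv]].
  rewrite big1 // => v' uv'; case: eqP; last by rewrite mul0r.
  by move=> /(g_inj uv uv')[uu _]; rewrite uu eqxx in nu.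
case: eqP; last by rewrite mul0r.
by move=> /(g_inj uv uv')[_ vv]; rewrite vv eqxx in nv.
Qed.

Lemma cost_free z : free z -> cost z = 0.
Proof.
move=> /andP[_ nz]; rewrite /cost big1 // => u _; rewrite big1 // => v uv.
by case: eqP => [E|_]; [rewrite E rep_edgeE in nz | rewrite mul0r].
Qed.

Lemma usable_swap z : usable z -> usable (z.2, z.1).
Proof.
move=> /andP[ez nz]; rewrite /usable /= dual_edge_sym // ez; apply: contra nz.
by move=> /existsP[u /andP[? ?]]; apply/existsP; exists u; apply/andP.
Qed.

Lemma free_swap z : free z -> free (z.2, z.1).
Proof.
move=> /andP[uz nz]; rewrite /free usable_swap //; apply: contra nz.
move=> /existsP[u /existsP[v /andP[uv /eqP E]]].
have -> : z = g v u by rewrite g_sym // -E -surjective_pairing.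
by apply: rep_edgeE; rewrite eH_sym.
Qed.

Definition free_connected := connect (step free).

Lemma free_connected_sym : symmetric free_connected.
Proof.
apply: sym_connect_sym; apply: step_sym => z; last exact: free_swap.
by move=> /andP[/andP[]].
Qed.

Lemma free_connected_gwalk x y : free_connected x y ->
  exists l, gwalk x l y /\ {in l, forall z, free z}.
Proof.
move=> /connectP[p pp ->]; have [|l [gw _ lf]] := path_gwalk _ pp; last by exists l.
by move=> z /andP[].
Qed.

(** A free walk between two terminals would yield a set of vertices of H that no edge leaves, hence
    a trivial one since H is connected, and yet this set would have to separate terminals. So
    contraction keeps terminals distinct. *)
Lemma free_connected_terminals i j : free_connected (t i) (t j) -> i = j.
Proof.
move=> /free_connected_gwalk[l [gw lf]].
have [||W [We Wt _]] := @usable_list_cut l.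
- exact: gwalk_usable gw.
- move=> v vt; rewrite (gwalk_boundary _ gw).
  have nv m : (t m == v) = false by apply: contraNF vt => /eqP <-; exact: codom_f.
  by rewrite !nv addr0.
have Wedge u v : eH u v -> (u \in W) = (v \in W).
  move=> uv; apply: boolF2_inj; apply: addF2_eq0; rewrite We // /crossings big_seq big1 // => z zl.
  have /andP[_ nz] := lf _ zl; rewrite -surjective_pairing -g_sym //.
  have -> : (z == g u v) = false by apply: contraNF nz => /eqP ->; exact: rep_edgeE.
  have -> : (z == g v u) = false.
    by apply: contraNF nz => /eqP ->; apply: rep_edgeE; rewrite eH_sym.
  by rewrite addr0.
have Wconst u v : (u \in W) = (v \in W).
  have /connectP[p] := H_conn u v; elim: p u => [u _ -> //|a p IH u /= /andP[/Wedge -> pp] E].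
  exact: IH E.
have := Wt i; rewrite (Wconst _ (tH i)) addF2K (gwalk_boundary _ gw) eqxx.
by case: eqP => [/t_inj //|_ /eqP].
Qed.

(** A class with a terminal is represented by it, without ambiguity since no class contains two. *)
Definition rep v := if [pick i | free_connected v (t i)] is Some i then t i
  else fingraph.root (step free) v.

Lemma rep_connect v : free_connected v (rep v).
Proof. by rewrite /rep; case: pickP => [i //|_]; exact: connect_root. Qed.

Lemma rep_eq v w : (rep v == rep w) = free_connected v w.
Proof.
have fs : connect_sym (step free) := free_connected_sym.
apply/eqP/idP => [E|vw].
  by apply: connect_trans (rep_connect v) _; rewrite E fs; exact: rep_connect.
rewrite /rep (eq_pick (Q := fun i => free_connected w (t i))) => [|i]; last first.
  exact: same_connect fs _ _ vw _.
by case: pickP => // _; apply/(fingraph.rootP fs).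
Qed.

Lemma rep_terminal i : rep (t i) = t i.
Proof.
rewrite /rep; case: pickP => [j /free_connected_terminals -> //|/(_ i)].
by rewrite /free_connected connect0.
Qed.

Lemma rep_idem v : rep (rep v) = rep v.
Proof. by apply/eqP; rewrite rep_eq free_connected_sym rep_connect. Qed.

Lemma rep_free_step z : free z -> rep (source z) = rep (target z).
Proof.
move=> fz; apply/eqP; rewrite rep_eq; apply: connect1; apply/existsP; exists z.
by rewrite fz !eqxx.
Qed.

Hypothesis eH_irr : irreflexive eH.
Variables (e : rel V) (i0 : 'I_k).
Hypothesis e_dart : forall d, e (tail d) (tail (rev d)).
Hypothesis terminals_separated : forall i j, exists S, separates i j S.

Definition reached v := connect (step usable) (t i0) v.

Lemma reached_step z : usable z -> reached (source z) -> reached (target z).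
Proof.
move=> uz r; apply: connect_trans r (connect1 _); apply/existsP; exists z.
by rewrite uz !eqxx.
Qed.

Lemma reached_gwalk x l y : gwalk x l y -> reached x -> reached y.
Proof.
elim: l x => [x /eqP -> //|z l IH x /= /and3P[uz /eqP <- gw] r].
by apply: IH gw _; exact: reached_step.
Qed.

Lemma reached_free x y : free_connected x y -> reached x -> reached y.
Proof. by move=> /free_connected_gwalk[l [gw _]]; exact: reached_gwalk gw. Qed.

Lemma reached_terminal i : reached (t i).
Proof.
have [S /gwalk_exists[l gw]] := terminals_separated i0 i.
by apply: reached_gwalk gw _; exact: connect0.
Qed.

(* Vertices of the contracted network are named by class representatives; classes
   cut off from the terminals are dropped to keep the network connected. *)
Definition cvertex := {v | (rep v == v) && reached v}.

Lemma cvertexP v : reached v -> (rep (rep v) == rep v) && reached (rep v).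
Proof. by move=> r; rewrite rep_idem eqxx; apply: reached_free r; exact: rep_connect. Qed.

Definition ct (i : 'I_k) : cvertex :=
  exist _ (rep (t i)) (cvertexP (reached_terminal i)).

(** The default [ct i0] is taken only at vertices cut off from the terminals. *)
Definition class v : cvertex := insubd (ct i0) (rep v).

Lemma val_class v : reached v -> val (class v) = rep v.
Proof. by move=> /cvertexP r; rewrite /class val_insubd r. Qed.

Lemma ctE i : ct i = class (t i).
Proof. by apply: val_inj; rewrite val_class //; exact: reached_terminal. Qed.

Lemma class_val (a : cvertex) : class (val a) = a.
Proof.
by apply: val_inj; have /andP[/eqP ra r] := valP a; rewrite val_class.
Qed.

Definition link_via (K K' : V) (p : VH * VH) :=
  [&& eH p.1 p.2, rep (source (g p.1 p.2)) == K & rep (target (g p.1 p.2)) == K'].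

Lemma link_via_swap K K' p : link_via K K' p -> link_via K' K (p.2, p.1).
Proof.
move=> /and3P[pe /eqP <- /eqP <-]; rewrite /link_via /= eH_sym pe g_sym //.
move: (source_swap (g_de pe)) (target_swap (g_de pe)); rewrite -surjective_pairing => -> ->.
by rewrite !eqxx.
Qed.

Definition cedge : rel cvertex :=
  [rel a b | (a != b) && [exists p, link_via (val a) (val b) p]].

(** Several edges of H may join the same two classes; the shortest is kept. The value 0 never occurs
    as a default on an edge of [cedge]. *)
Definition clength (a b : cvertex) : R :=
  if [pick p | link_via (val a) (val b) p] is Some p0 then
    let p := [arg min_(p < p0 | link_via (val a) (val b) p) cH p.1 p.2]%O in cH p.1 p.2
  else 0.

Lemma clength_attained a b : cedge a b ->
  exists2 p, link_via (val a) (val b) p & clength a b = cH p.1 p.2.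
Proof.
move=> /andP[_ /existsP[p lp]]; rewrite /clength.
case: pickP => [p0 lp0|/(_ p)]; last by rewrite lp.
by case: arg_minP => // q lq _; exists q.
Qed.

Lemma clength_le a b p : link_via (val a) (val b) p -> clength a b <= cH p.1 p.2.
Proof.
move=> lp; rewrite /clength; case: pickP => [p0 lp0|/(_ p)]; last by rewrite lp.
by case: arg_minP => // q lq; apply.
Qed.

Lemma cedge_sym : symmetric cedge.
Proof.
suff H a b : cedge a b -> cedge b a by move=> a b; apply/idP/idP; exact: H.
move=> /andP[ab /existsP[p lp]]; rewrite /cedge /= eq_sym ab; apply/existsP.
by exists (p.2, p.1); exact: link_via_swap.
Qed.

Lemma clength_sym a b : cedge a b -> clength a b = clength b a.
Proof.
have H a' b' : cedge a' b' -> clength b' a' <= clength a' b'.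
  move=> /clength_attained[p lp ->].
  by apply: le_trans (clength_le (link_via_swap lp)) _; rewrite cH_sym // eH_sym; case/and3P: lp.
by move=> ab; apply/eqP; rewrite eq_le !H // cedge_sym.
Qed.

Lemma link_usable K K' p : link_via K K' p -> usable (g p.1 p.2).
Proof.
move=> /and3P[pe _ _]; apply: rep_edge_usable => //.
by apply: contraTneq pe => ->; rewrite eH_irr.
Qed.

Lemma usable_cases z : usable z -> free z \/ exists2 p, eH p.1 p.2 & z = g p.1 p.2.
Proof.
rewrite /free => uz; rewrite uz; case: (boolP (rep_edge z)) => [|_]; last by left.
by move=> /existsP[u /existsP[v /andP[uv /eqP ->]]]; right; exists (u, v).
Qed.

Lemma class_step z : usable z -> reached (source z) ->
  class (source z) = class (target z) \/
  cedge (class (source z)) (class (target z)) /\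
    clength (class (source z)) (class (target z)) <= cost z.
Proof.
move=> uz r; have r' := reached_step uz r.
have ceq x y : reached x -> reached y -> rep x = rep y -> class x = class y.
  by move=> rx ry E; apply: val_inj; rewrite !val_class.
case: (usable_cases uz) => [/rep_free_step E|[p pe E]]; first by left; exact: ceq.
case: (eqVneq (class (source z)) (class (target z))) => [->|ne]; [by left|right].
have lp : link_via (val (class (source z))) (val (class (target z))) p.
  by rewrite /link_via pe !val_class // E !eqxx.
split; first by rewrite /cedge /= ne; apply/existsP; exists p.
by rewrite E cost_rep_edge // -E; exact: clength_le.
Qed.

Lemma gwalk_cwalk x l y : gwalk x l y -> reached x ->
  exists p, [/\ path cedge (class x) p, last (class x) p = class y &
    walk_length clength (class x) p <= \sum_(z <- l) cost z].
Proof.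
elim: l x => [x /eqP -> _|z l IH x /= /and3P[uz /eqP <- gw] r].
  by exists [::]; rewrite /walk_length /= !big_nil.
have [p [pp pl pw]] := IH _ gw (reached_step uz r).
rewrite big_cons; case: (class_step uz r) => [->|[ce cl]].
  by exists p; split=> //; rewrite -[X in X <= _]add0r lerD ?cost_ge0.
exists (class (target z) :: p); split=> //=; first by rewrite ce.
by rewrite /walk_length /= big_cons lerD.
Qed.

(** Consecutive links may meet a class in different vertices; free walks inside the class bridge the
    gap at no cost. *)
Lemma cwalk_gwalk (a : cvertex) p : path cedge a p ->
  exists l, gwalk (val a) l (val (last a p)) /\ \sum_(z <- l) cost z = walk_length clength a p.
Proof.
elim: p a => [a _|b p IH a /= /andP[ab /IH[l [gw lc]]]].
  by exists [::]; rewrite /walk_length !big_nil /=.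
have [q lq qc] := clength_attained ab; have /and3P[qe /eqP qa /eqP qb] := lq.
have free0 l' : {in l', forall z, free z} -> \sum_(z <- l') cost z = 0.
  by move=> lf; rewrite big_seq big1 // => z /lf /cost_free.
have [l1 [gw1 /free0 c1]] : exists l1,
    gwalk (val a) l1 (source (g q.1 q.2)) /\ {in l1, forall z, free z}.
  by apply: free_connected_gwalk; rewrite free_connected_sym -qa rep_connect.
have [l2 [gw2 /free0 c2]] : exists l2,
    gwalk (target (g q.1 q.2)) l2 (val b) /\ {in l2, forall z, free z}.
  by apply: free_connected_gwalk; rewrite -qb rep_connect.
exists (l1 ++ g q.1 q.2 :: l2 ++ l); split.
  apply: gwalk_cat gw1 _; rewrite /= (link_usable lq) eqxx /=; exact: gwalk_cat gw2 gw.
by rewrite /walk_length !(big_cat, big_cons) /= c1 c2 !add0r cost_rep_edge // lc qc.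
Qed.

Lemma dist_ct i j : dist cedge clength (ct i) (ct j) =
  inf [set r | exists l, gwalk (t i) l (t j) /\ r = \sum_(z <- l) cost z]%classic.
Proof.
have cw l : gwalk (t i) l (t j) -> exists p, [/\ path cedge (ct i) p, last (ct i) p = ct j &
    walk_length clength (ct i) p <= \sum_(z <- l) cost z].
  by move=> gw; rewrite !ctE; apply: gwalk_cwalk gw _; exact: reached_terminal.
have wc p : path cedge (ct i) p -> last (ct i) p = ct j ->
    exists l, gwalk (t i) l (t j) /\ \sum_(z <- l) cost z = walk_length clength (ct i) p.
  by move=> pp pl; have := cwalk_gwalk pp; rewrite pl /= !rep_terminal.
apply: inf_eq_dominated.
- have [S /gwalk_exists[l /cw[p [pp pl _]]]] := terminals_separated i j.
  by exists (walk_length clength (ct i) p), p.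
- move=> _ [p [pp pl ->]]; have [l [_ <-]] := wc _ pp pl.
  by apply: sumr_ge0 => z _; exact: cost_ge0.
- by move=> _ [l [_ ->]]; apply: sumr_ge0 => z _; exact: cost_ge0.
- move=> _ [p [pp pl ->]]; have [l [gw <-]] := wc _ pp pl.
  by exists (\sum_(z <- l) cost z) => //; exists l.
- move=> _ [l [/cw[p [pp pl pw]] ->]].
  by exists (walk_length clength (ct i) p) => //; exists p.
Qed.

Lemma contracted_network : is_network cedge clength ct.
Proof.
split.
- by split; [exact: cedge_sym | move=> a; rewrite /cedge /= eqxx].
- exact: clength_sym.
- by move=> a b /clength_attained[p /and3P[pe _ _] ->]; exact: cH_ge0.
- by move=> i j /(congr1 val) /=; rewrite !rep_terminal => /t_inj.
have root_conn b : connect cedge (ct i0) b.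
  have /andP[_ /connectP[p pp bE]] := valP b.
  have [l [gw _ _]] := path_gwalk (P := usable) (fun _ uz => uz) pp.
  have [q [qp ql _]] := gwalk_cwalk gw (reached_terminal i0).
  by rewrite -(class_val b) bE -ql ctE; apply/connectP; exists q.
by move=> a b; apply: connect_trans (root_conn b); rewrite (sym_connect_sym cedge_sym).
Qed.

(** The branch sets are the whole classes, connected through free edges. *)
Lemma contracted_minor : is_minor_terminals e cedge t ct.
Proof.
exists (fun a => [set v | rep v == val a]); split; last by move=> i; rewrite inE /=.
split.
- move=> a; apply/set0Pn; exists (val a); rewrite inE; by case/andP: (valP a).
- move=> a b ab; rewrite -setI_eq0; apply/eqP/setP => v; rewrite !inE.
  by apply: contraNF ab => /andP[/eqP va /eqP vb]; apply/eqP/val_inj; rewrite -va.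
- move=> a x y; rewrite !inE => /eqP xa /eqP ya.
  have : free_connected x y by rewrite -rep_eq xa ya.
  case/connectP => p; elim: p x xa => [x _ _ ->|v p IH x xa /= /andP[xv pp] yE].
    exact: connect0.
  have va : rep v = val a.
    by rewrite -xa; apply/eqP; rewrite eq_sym rep_eq; exact: connect1.
  apply: connect_trans (IH v va pp yE); apply: connect1 => /=.
  rewrite !inE xa va eqxx !andbT.
  by have /existsP[z /and3P[_ /eqP <- /eqP <-]] := xv; exact: e_dart.
- move=> a b /andP[_ /existsP[p /and3P[pe pa pb]]].
  exists (source (g p.1 p.2)), (target (g p.1 p.2)); rewrite !inE pa pb; split=> //.
  exact: e_dart.
Qed.

(** * Counting the vertices of the contracted network *)

Hypothesis tail_psi : forall Y : V -> 'F_2, (forall i, Y (t i) = 0) ->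
  forall d, Y (tail (psi d)) = Y (tail (rev d)).

(** Incidence modulo 2: an edge with both ends in the class, a loop after contraction, counts
    zero. *)
Definition at_class (v : V) (p : VH * VH) : 'F_2 :=
  (rep (source (g p.1 p.2)) == v)%:R + (rep (target (g p.1 p.2)) == v)%:R.

Lemma at_class_swap v p : eH p.1 p.2 -> at_class v (p.2, p.1) = at_class v p.
Proof.
move=> pe; rewrite /at_class /= g_sym //.
move: (source_swap (g_de pe)) (target_swap (g_de pe)); rewrite -surjective_pairing => -> ->.
by rewrite addrC.
Qed.

(** The edges leaving a class form a cut of G, so they meet every face evenly: around a face the
    indicator [Y] returns to its start, and the jumps of [psi] join terminals, where [Y] vanishes.
    Summed over a branch set, the edges inside it cancel, and free edges do not leave a class. *)
Lemma at_class_even v u : v \notin codom t -> \sum_(w | eH u w) at_class v (u, w) = 0.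
Proof.
move=> vt; pose Y x : 'F_2 := (rep x == v)%:R.
have Yt i : Y (t i) = 0.
  rewrite /Y rep_terminal; have -> // : (t i == v) = false.
  by apply: contraNF vt => /eqP <-; exact: codom_f.
pose dY x y := Y (source (x, y)) + Y (target (x, y)).
have dYsym x y : de x y -> dY y x = dY x y.
  by move=> xy; rewrite /dY (source_swap xy) (target_swap xy) addrC.
have degree x : \sum_(y | de x y) dY x y = 0.
  rewrite big_sumType /=; case: x => [w|d].
    rewrite big_pred0 // add0r /dY /edge_source /edge_target /= big_split /=.
    have -> : \sum_(d | w == face_of psi d) Y (tail (rev d)) =
        \sum_(d | w == face_of psi d) Y (tail d).
      rewrite [RHS](reindex_inj (@perm_inj _ psi)) /=.
      by apply: eq_big => [d|d _]; rewrite ?face_of_psi // tail_psi.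
    exact: addF2K.
  rewrite (big_pred1 (face_of psi d)) // (big_pred1 (rev d)) //.
  by rewrite /dY /edge_source /edge_target /= revK [X in _ + X]addrC addF2K.
have : \sum_(x in phi u) \sum_(y | de x y) dY x y = 0 by rewrite big1.
under eq_bigr do rewrite (bigID [in phi u]) /=.
rewrite big_split /= [X in X + _](_ : _ = 0) ?add0r; last first.
  pose f x y := if [&& x \in phi u, y \in phi u & de x y] then dY x y else 0.
  rewrite -[RHS](@sum_symmetric_pairs_F2 _ f); last first.
  - by move=> x; rewrite /f dual_edge_irr // !andbF.
  - move=> x y; rewrite /f dual_edge_sym // [X in if X then _ else _]andbCA.
    by case: and3P => // -[_ _ yx]; rewrite dYsym // dual_edge_sym.
  rewrite big_mkcond; apply: eq_bigr => x _; case: ifP => xu; last first.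
    by rewrite big1 // => y _; rewrite /f xu.
  rewrite big_mkcond; apply: eq_bigr => y _; rewrite /f xu andbC /=.
  by case: (_ && _).
(* An edge leaving the branch set of [u] is either free, with both ends in one class, or the chosen
   edge of exactly one edge of H at [u]. *)
have picks x y : x \in phi u -> y \notin phi u -> de x y ->
    dY x y = \sum_(w | eH u w) ((x, y) == g u w)%:R * dY x y.
  move=> xu yu xy; have us : usable (x, y).
    rewrite /usable xy; apply: contra yu => /existsP[u' /andP[/= xu' yu']].
    by rewrite (phi_inj xu xu').
  case: (usable_cases us) => [/rep_free_step E|[[u' w] /= uw E]].
    by rewrite /dY /Y E addF2K big1 // => w _; rewrite mulr0.
  have uu : u' = u by apply: (phi_inj (g1 uw)); rewrite -E.
  rewrite uu in uw E; rewrite (bigD1 w) //= E eqxx mul1r big1 ?addr0 // => w' /andP[uw' ww].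
  case: eqP; last by rewrite mul0r.
  by move=> /(g_inj uw uw')[_ wE]; rewrite wE eqxx in ww.
move=> sum0; rewrite -[RHS]sum0 [RHS](eq_bigr (fun x => \sum_(y | de x y && (y \notin phi u))
   \sum_(w | eH u w) ((x, y) == g u w)%:R * dY x y)); last first.
  by move=> x xu; apply: eq_bigr => y /andP[xy yu]; exact: picks.
under [RHS]eq_bigr do rewrite exchange_big.
rewrite [RHS]exchange_big /=; apply: eq_bigr => w uw.
rewrite (bigD1 (g u w).1) ?g1 //= (bigD1 (g u w).2) /=; last first.
  rewrite g_de //=; apply/negP => w2; have := uw.
  by rewrite (phi_inj w2 (g2 uw)) eH_irr.
rewrite -surjective_pairing eqxx mul1r !big1 ?addr0 //.
- move=> x /andP[_ nx]; rewrite big1 // => y _; case: eqP; last by rewrite mul0r.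
  by move=> E; rewrite -E eqxx in nx.
- move=> y /andP[_ ny]; case: eqP; last by rewrite mul0r.
  by move=> E; rewrite -E eqxx in ny.
Qed.

Definition touched : {set V} :=
  [set v | (v \notin codom t) && [exists p : VH * VH, eH p.1 p.2 && (at_class v p != 0)]].

Definition leaving v : {set VH * VH} :=
  [set p | [&& eH p.1 p.2, rep (source (g p.1 p.2)) == v & rep (target (g p.1 p.2)) != v]].

Lemma at_class_leaving v p : eH p.1 p.2 -> at_class v p != 0 ->
  exists2 q, q \in leaving v & q = p \/ q = (p.2, p.1).
Proof.
move=> pe; rewrite /at_class; case: (boolP (_ == v)) => s; case: (boolP (_ == v)) => r //= _.
  by exists p; [rewrite inE pe s r | left].
exists (p.2, p.1); last by right.
rewrite inE /= eH_sym pe g_sym //.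
move: (source_swap (g_de pe)) (target_swap (g_de pe)); rewrite -surjective_pairing => -> ->.
by rewrite s r.
Qed.

(* A nonterminal class is bounded by a cycle of the simple graph H. *)
Lemma card_leaving v : v \in touched -> (3 <= #|leaving v|)%N.
Proof.
rewrite inE => /andP[vt /existsP[p0 /andP[p0e /(at_class_leaving p0e)[[u w] uwl _]]]].
move: (uwl); rewrite inE /= => /and3P[uw us ut].
have c1 : at_class v (u, w) != 0 by rewrite /at_class /= us (negPf ut).
have wu : eH w u by rewrite eH_sym.
have c2 : at_class v (w, u) != 0 by rewrite (@at_class_swap v (u, w)).
have another x y : eH x y -> at_class v (x, y) != 0 ->
    exists2 y', y' != y & eH x y' /\ at_class v (x, y') != 0.
  move=> xy cxy; have := at_class_even x vt; rewrite (bigD1 y) //= => s0.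
  have : \sum_(w' | eH x w' && (w' != y)) at_class v (x, w') != 0.
    by apply: contraNneq cxy => s1; rewrite s1 addr0 in s0; rewrite s0.
  case: (pickP (fun y' => [&& y' != y, eH x y' & at_class v (x, y') != 0])) =>
    [y' /and3P[? ? ?] _|no].
    by exists y'.
  rewrite big1 ?eqxx // => y' /andP[xy' ny]; have := no y'; rewrite xy' ny /=.
  by move=> /negbT; rewrite negbK => /eqP.
(* By evenness the edge from [u] to [w] is continued at both ends; since H is simple, the two
   continuations are distinct from it and from each other. *)
have [w' nw [uw' c3]] := another _ _ uw c1.
have [x nx [wx c4]] := another _ _ wu c2.
have irr a b : eH a b -> a != b by apply: contraTneq => ->; rewrite eH_irr.
have [q ql qE] := at_class_leaving (p := (u, w')) uw' c3.
have [r rl rE] := at_class_leaving (p := (w, x)) wx c4.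
have uniq3 : uniq [:: (u, w); q; r].
  have := irr _ _ uw; have := irr _ _ uw'; have := irr _ _ wx; move: nw nx.
  rewrite /= !inE !negb_or !andbT => nw nx wx' uw1 uw2.
  by case: qE => ->; case: rE => ->; rewrite !xpair_eqE /= !negb_and;
    rewrite ?nw ?nx ?wx' ?uw1 ?uw2 ?orbT ?(eq_sym w w') ?(eq_sym u x) ?(eq_sym w u) ?(eq_sym u w')
      ?nw ?nx ?wx' ?uw1 ?uw2 ?orbT.
rewrite -[3%N]/(size [:: (u, w); q; r]) -(card_uniqP uniq3); apply/subset_leq_card/fintype.subsetP.
by move=> p; rewrite !inE => /or3P[] /eqP ->; [move: uwl | move: ql | move: rl]; rewrite inE.
Qed.

Lemma sum_leaving : (\sum_(v in touched) #|leaving v| <= #|{: dart eH}|)%N.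
Proof.
have -> : #|{: dart eH}| = #|[set p : VH * VH | eH p.1 p.2]|.
  by rewrite card_sig; apply: eq_card => p; rewrite !inE /dartP [eH p.2 p.1]eH_sym andbb.
rewrite -sum1_card (partition_big (fun p => rep (source (g p.1 p.2))) predT) //=.
rewrite [X in (_ <= X)%N](bigID [in touched]) /=; apply: leq_trans (leq_addr _ _).
apply: leq_sum => v _; rewrite sum1dep_card; apply/subset_leq_card/fintype.subsetP => p.
by rewrite !inE => /and3P[-> ->].
Qed.

(** Each chosen edge is prolonged by free walks to the representatives of its two classes, so that
    boundaries are those of the contracted graph; free edges do not affect the crossings of chosen
    ones. *)
Lemma edge_list_chain (s : seq (VH * VH)) : {in s, forall p, eH p.1 p.2} ->
  exists l, [/\ {in l, forall z, usable z},
    forall v, boundary l v = \sum_(p <- s) at_class v p &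
    forall u v, eH u v -> crossings l (g u v).1 (g u v).2 =
      \sum_(p <- s) ((p == (u, v))%:R + (p == (v, u))%:R)].
Proof.
elim: s => [_|p s IH se].
  by exists [::]; split=> // *; rewrite /chain_boundary /crossings !big_nil.
have [|l [lu lb lc]] := IH; first by move=> q qs; apply: se; rewrite inE qs orbT.
have pe : eH p.1 p.2 by apply: se; rewrite inE eqxx.
have [l1 [gw1 f1]] : exists l1, gwalk (rep (source (g p.1 p.2))) l1 (source (g p.1 p.2)) /\
    {in l1, forall z, free z}.
  by apply: free_connected_gwalk; rewrite free_connected_sym rep_connect.
have [l2 [gw2 f2]] : exists l2, gwalk (target (g p.1 p.2)) l2 (rep (target (g p.1 p.2))) /\
    {in l2, forall z, free z}.
  by apply: free_connected_gwalk; rewrite rep_connect.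
have pu : usable (g p.1 p.2).
  by apply: rep_edge_usable => //; apply: contraTneq pe => ->; rewrite eH_irr.
have gwp : gwalk (rep (source (g p.1 p.2))) (l1 ++ g p.1 p.2 :: l2) (rep (target (g p.1 p.2))).
  by apply: gwalk_cat gw1 _; rewrite /= pu eqxx.
exists ((l1 ++ g p.1 p.2 :: l2) ++ l); split.
- by move=> z; rewrite mem_cat => /orP[/(gwalk_usable gwp)|/lu].
- move=> v; rewrite big_cons -lb /chain_boundary big_cat /=; congr (_ + _).
  exact: gwalk_boundary gwp.
move=> u v uv; rewrite big_cons -lc // /crossings big_cat /=; congr (_ + _).
have fc l' : {in l', forall z, free z} -> crossings l' (g u v).1 (g u v).2 = 0.
  move=> lf; rewrite /crossings big_seq big1 // => z zl.
  have /andP[_ nz] := lf _ zl; rewrite -surjective_pairing -g_sym //.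
  have -> : (z == g u v) = false by apply: contraNF nz => /eqP ->; exact: rep_edgeE.
  have -> : (z == g v u) = false.
    by apply: contraNF nz => /eqP ->; apply: rep_edgeE; rewrite eH_sym.
  by rewrite addr0.
have := fc _ f1; have := fc _ f2; rewrite /crossings => E2 E1.
rewrite big_cat big_cons /= E1 E2 add0r addr0 -surjective_pairing -g_sym //.
have gE a b : eH a b -> (g p.1 p.2 == g a b) = (p == (a, b)).
  move=> ab; apply/eqP/eqP => [/(g_inj pe ab)[<- <-]|-> //]; exact: surjective_pairing.
by rewrite !gE // eH_sym.
Qed.

(** An edge set of H meeting every touched class evenly is closed away from the terminals, hence a
    cut of H. So the vertex stars and the cycles around touched classes together have rank at least
    the number of edges. *)
Lemma card_edges_le : (#|{: {d : dart eH | oriented (@dart_rev _ eH) d}}| <=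
  #|VH| + #|[pred v | v \in touched]|)%N.
Proof.
have revn (d : dart eH) : dart_rev d != d.
  apply/eqP => /(congr1 val); case: d => [[a b] ab] /= [E _]; move: ab.
  by rewrite /dartP /= E eH_irr.
rewrite -card_sig.
pose E : finType := {d : dart eH | oriented (@dart_rev _ eH) d}.
pose pr (p : E) : VH * VH := val (val p).
have pre (p : E) : eH (pr p).1 (pr p).2 by have /andP[] := valP (val p).
apply: (@card_leq_row_space _ VH {v | v \in touched} E
   (fun u p => (u == (pr p).1)%:R + (u == (pr p).2)%:R) (fun v p => at_class (val v) (pr p))).
move=> y yN; pose s := [seq pr p | p <- enum E & y p != 0].
have sumS (f : VH * VH -> 'F_2) : \sum_(p <- s) f p = \sum_p y p * f (pr p).
  rewrite big_map big_filter big_enum_cond /= big_mkcond; apply: eq_bigr => p _.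
  by rewrite [y p]F2_bool; case: (y p != 0); rewrite ?mul1r ?mul0r.
have [|l [lu lb lc]] := @edge_list_chain s; first by move=> _ /mapP[p _ ->].
have [|WH [We _ _]] := usable_list_cut lu.
  move=> v vt; rewrite lb sumS; case: (boolP (v \in touched)) => [vT|].
    exact: (yN (exist _ v vT)).
  rewrite inE vt /= => /existsPn no; rewrite big1 // => p _.
  by have := no (pr p); rewrite pre /= negbK => /eqP ->; rewrite mulr0.
exists (fun u => (u \in WH)%:R) => q; have := We _ _ (pre q); rewrite lc // sumS.
have -> : \sum_p y p * ((pr p == ((pr q).1, (pr q).2))%:R
                      + (pr p == ((pr q).2, (pr q).1))%:R) = y q.
  rewrite (bigD1 q) //= -surjective_pairing eqxx big1 => [|p pq].
    have -> : (pr q == ((pr q).2, (pr q).1)) = false.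
      by apply/eqP => E0; have := revn (val q); rewrite -val_eqE /= -/(pr q) -E0 eqxx.
    by rewrite !addr0 mulr1.
  rewrite !(inj_eq val_inj) (negPf pq) add0r.
  have -> : (pr p == ((pr q).2, (pr q).1)) = false; last by rewrite mulr0.
  apply/eqP => E0; have E1 : val p = dart_rev (val q) by apply: val_inj.
  have := valP p; rewrite E1 (oriented_rev (@dart_revK _ eH) revn) (valP q) //.
move=> <-.
have sumd x : \sum_u (u \in WH)%:R * (u == x)%:R = (x \in WH)%:R :> 'F_2.
  rewrite (bigD1 x) //= eqxx mulr1 big1 ?addr0 // => u /negPf ->; exact: mulr0.
by under eq_bigr do rewrite mulrDr; rewrite big_split /= !sumd.
Qed.

(** Let H have [n] vertices and [m] edges, and let [f] classes be touched. Each is left by at least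
    3 of the [2 m] darts, so [3 f <= 2 m]; with [m <= n + f] this gives [f <= 2 n]. *)
Lemma card_touched : (#|[pred v | v \in touched]| <= 2 * #|VH|)%N.
Proof.
have revn (d : dart eH) : dart_rev d != d.
  apply/eqP => /(congr1 val); case: d => [[a b] ab] /= [E _]; move: ab.
  by rewrite /dartP /= E eH_irr.
have c3 : (3 * #|[pred v | v \in touched]| <= #|{: dart eH}|)%N.
  apply: leq_trans sum_leaving; rewrite mulnC -sum_nat_const.
  by apply: leq_sum => v /card_leaving.
move: c3; rewrite (card_oriented (@dart_revK _ eH) revn); move: card_edges_le.
have arith a b c : (a <= b + c -> 3 * c <= 2 * a -> c <= 2 * b)%N by lia.
exact: arith.
Qed.

(** A walk from a terminal must enter the class by a usable edge that is not free, and this is a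
    chosen edge with exactly one end in the class. *)
Lemma cvertex_touched (a : cvertex) : val a \notin codom t -> val a \in touched.
Proof.
move=> at'; rewrite inE at'; apply: contraT => /existsPn no.
have /andP[/eqP ra /connectP[p pp aE]] := valP a.
have : rep (t i0) != val a.
  by rewrite rep_terminal; apply: contraNneq at' => <-; exact: codom_f.
elim: p (t i0) pp aE => [x _ /= <-|y p IH x /= /andP[xy pp] yE rx]; first by rewrite ra eqxx.
apply: IH pp yE _.
have /existsP[z /and3P[uz /eqP zx /eqP zy]] := xy.
case: (usable_cases uz) => [/rep_free_step|[q qe zE]]; first by rewrite zx zy => <-.
have := no q; rewrite qe /= negbK /at_class -zE zx zy (negPf rx) add0r.
by case: (rep y == val a).
Qed.

(** The factor 3 is 2 for the nonterminal classes plus 1 for the terminals, of which H has at most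
    [#|VH|]. *)
Lemma card_cvertex : (#|{: cvertex}| <= 3 * #|VH|)%N.
Proof.
have cT : (#|{: cvertex}| <= #|[pred v | v \in touched]| + #|codom t|)%N.
  rewrite -(card_image (f := val : cvertex -> V) val_inj).
  apply: (@leq_trans #|[predU [pred v | v \in touched] & codom t]|); last first.
    by rewrite -cardUI leq_addr.
  apply/subset_leq_card/fintype.subsetP => _ /fintype.imageP[a _ ->].
  by apply/orP; case: (boolP (val a \in codom t)) => [|/cvertex_touched]; [right|left].
have kH : (#|codom t| <= #|VH|)%N by rewrite card_codom // -(card_codom tH_inj) max_card.
have arith a b c d : (a <= b + c -> c <= d -> b <= 2 * d -> a <= 3 * d)%N by lia.
exact: arith cT kH card_touched.
Qed.

End MinorOfDual.

(** * Distances of G as minimum cuts of its dual *)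

Lemma inf_eq0 (A : classical_sets.set R) : A 0 -> (forall x, A x -> 0 <= x) -> inf A = 0.
Proof.
move=> A0 Age; apply/eqP; rewrite eq_le; apply/andP; split.
  by apply: ge_inf A0; exists 0.
by apply: lb_le_inf => //; exists 0.
Qed.

Section PlaneNetwork.
Variables (V : finType) (e : rel V) (c : V -> V -> R).
Local Notation D := (dart e).
Local Notation rev := (@dart_rev V e).
Local Notation tail := (@dart_tail V e).
Variables (psi : {perm D}) (k : nat) (t : 'I_k -> V) (dt : 'I_k -> D) (th : 'I_k -> 'I_k).
Variable i0 : 'I_k.
Local Notation dv := (dual_vertex psi).
Local Notation de := (@dual_edge D rev psi).
Local Notation base := (@dual_base D rev psi).
Local Notation td := (dual_terminal psi dt).
Local Notation boundary := (@chain_boundary V D rev tail psi).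

(** Each of the three pieces carries the full length of the edge of G, so a cut may cross the path
    at any one of them for the same price. *)
Definition dual_weight (x y : dv) : R := c (val (base x y)).1 (val (base x y)).2.

Hypothesis net : is_network e c t.
Hypothesis td_inj : injective td.
Hypothesis rev_neq : forall d : D, rev d != d.
Hypothesis list_cob : forall l : seq (dv * dv),
  {in l, forall z, de z.1 z.2} -> (forall v, v \notin codom t -> boundary l v = 0) ->
  exists W : dv -> 'F_2, (forall x y, de x y -> W x + W y = crossings l x y) /\
    (forall i, W (td i) + W (td (th i)) = boundary l (t i)).
Hypothesis term_cob : forall (W : dv -> 'F_2) v,
  \sum_(d | tail d == v) (W (inl (face_of psi d)) + W (inl (face_of psi (rev d)))) =
  \sum_(i | t i == v) (W (td i) + W (td (th i))).
Hypothesis th_trans : forall P : 'I_k -> bool,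
  (forall l, P (th l) = P l) -> forall l m, P l = P m.
Hypothesis tail_psi : forall Y : V -> 'F_2, (forall i, Y (t i) = 0) ->
  forall d, Y (tail (psi d)) = Y (tail (rev d)).

Let revK : involutive rev := @dart_revK V e.
Let t_inj : injective t. Proof. by case: net. Qed.
Let e_sym : symmetric e. Proof. by case: net => [[]]. Qed.

Lemma dual_weight_sym x y : de x y -> dual_weight x y = dual_weight y x.
Proof.
move=> xy; have [_ csym _ _ _] := net; rewrite /dual_weight (dual_base_rev revK xy) /=.
by rewrite csym //; case/andP: (valP (base x y)).
Qed.

Lemma dual_weight_ge0 x y : de x y -> 0 <= dual_weight x y.
Proof. by move=> _; have [_ _ cge _ _] := net; apply: cge; case/andP: (valP (base x y)). Qed.

(* The trivial minor of the dual yields G itself. *)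
Let phi1 (x : dv) : {set dv} := [set x].
Let g1 (x y : dv) : dv * dv := (x, y).
Local Notation gwalk1 := (gwalk rev tail phi1).
Local Notation cost1 := (@cost D psi dv de dual_weight g1).

Let phi1_inj u v x : x \in phi1 u -> x \in phi1 v -> u = v.
Proof. by rewrite !inE => /eqP -> /eqP ->. Qed.
Let phi1_conn u x y : x \in phi1 u -> y \in phi1 u ->
  connect [rel a b | [&& de a b, a \in phi1 u & b \in phi1 u]] x y.
Proof. by rewrite !inE => /eqP -> /eqP ->; exact: connect0. Qed.
Let phi1_td i : td i \in phi1 (td i). Proof. by rewrite inE. Qed.
Let g1_1 u v : de u v -> (g1 u v).1 \in phi1 u. Proof. by rewrite inE. Qed.
Let g1_2 u v : de u v -> (g1 u v).2 \in phi1 v. Proof. by rewrite inE. Qed.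
Let g1_de u v : de u v -> de (g1 u v).1 (g1 u v).2. Proof. by []. Qed.
Let g1_sym u v : de u v -> g1 v u = ((g1 u v).2, (g1 u v).1). Proof. by []. Qed.
Let de_sym : symmetric de := dual_edge_sym revK.

Lemma cost_trivial z : de z.1 z.2 -> cost1 z = dual_weight z.1 z.2.
Proof.
by case: z => x y /= xy; exact: (cost_rep_edge dual_weight phi1_inj g1_1 g1_2 xy).
Qed.

Lemma usable_trivial z : de z.1 z.2 -> usable rev phi1 z.
Proof.
move=> ez; rewrite /usable ez; apply/existsP => -[u]; rewrite !inE => /andP[/eqP z1 /eqP z2].
by move: ez; rewrite z1 z2 dual_edge_irr.
Qed.

Lemma path_gwalk1 x p : path e x p ->
  exists l, gwalk1 x l (last x p) /\ \sum_(z <- l) cost1 z = walk_length c x p.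
Proof.
elim: p x => [x _|y p IH x /= /andP[xy /IH[l [gw lc]]]].
  by exists [::]; rewrite /walk_length /= !big_nil.
have dxy : dartP e (x, y) by rewrite /dartP /= xy e_sym.
pose d : D := exist (fun p => dartP e p) (x, y) dxy.
have zd : de (inr d) (inr (rev d)) by rewrite /=.
(* Any of the three pieces could represent the step along [d]; the middle one is used. *)
exists ((inr d, inr (rev d)) :: l); split.
  by rewrite /= usable_trivial //= /edge_source /= eqxx.
by rewrite /walk_length /= !big_cons lc cost_trivial.
Qed.

Lemma gwalk1_path x l y : gwalk1 x l y ->
  exists p, [/\ path e x p, last x p = y & walk_length c x p = \sum_(z <- l) cost1 z].
Proof.
elim: l x => [x /eqP ->|z l IH x /= /and3P[/andP[ez _] /eqP zx /IH[p [pp pl pw]]]].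
  by exists [::]; rewrite /walk_length /= !big_nil.
exists (edge_target rev tail z :: p); split=> //=.
  by rewrite pp andbT -zx; case/andP: (valP (base z.1 z.2)).
by rewrite /walk_length /= !big_cons -pw cost_trivial // -zx.
Qed.

Lemma dist_gwalk i j : dist e c (t i) (t j) =
  inf [set r | exists l, gwalk1 (t i) l (t j) /\ r = \sum_(z <- l) cost1 z]%classic.
Proof.
have [_ _ cge _ econ] := net.
have cost0 l : 0 <= \sum_(z <- l) cost1 z.
  by apply: sumr_ge0 => z _; apply: cost_ge0; exact: dual_weight_ge0.
apply: inf_eq_dominated.
- have /connectP[p pp pl] := econ (t i) (t j).
  by exists (walk_length c (t i) p), p.
- by move=> _ [p [/path_gwalk1[l [_ <-]] _ ->]].
- by move=> _ [l [_ ->]].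
- move=> _ [p [/path_gwalk1[l [gw <-]] pl ->]]; exists (\sum_(z <- l) cost1 z) => //.
  by exists l; rewrite -pl.
- move=> _ [l [/gwalk1_path[p [pp pl pw]] ->]].
  by exists (walk_length c (t i) p); [exists p | rewrite pw].
Qed.

(** No arc is built explicitly: a path of G from [t i] to [t j] determines a cut by duality, and [S]
    is its set of terminals. *)
Lemma terminals_separated i j : exists S, separates th i j S.
Proof.
have [_ _ _ _ econ] := net.
have /connectP[p /path_gwalk1[l [gw _]] pl] := econ (t i) (t j).
rewrite -pl in gw.
have [WH [sW _]] := gwalk_cut t_inj list_cob de_sym dual_weight_sym dual_weight_ge0
  phi1_conn phi1_td g1_1 g1_2 g1_de g1_sym gw.
by eexists; exact: sW.
Qed.

Lemma dist_mincut_dual i j S : separates th i j S ->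
  dist e c (t i) (t j) = mincut de dual_weight td S.
Proof.
move=> sS; rewrite dist_gwalk; apply/esym.
exact: (mincut_gwalk revK rev_neq t_inj list_cob term_cob de_sym dual_weight_sym
  dual_weight_ge0 phi1_inj phi1_conn phi1_td g1_1 g1_2 g1_de g1_sym th_trans td_inj sS).
Qed.

Lemma separates_proper i j S : i != j -> separates th i j S ->
  S != finset.set0 /\ S != finset.setT.
Proof.
move=> ij sS.
by split; apply/eqP => E; move: (sS i); rewrite E !inE eqxx (negPf ij).
Qed.

Lemma sparsified_dual_DAM (q s : R) :
  has_minor_cut_sparsifier de dual_weight td q s -> has_DAM e c t q (3%:R * s).
Proof.
move=> [VH [eH [cH [tH [netH [phi [[phi0 phid phic phie] phit]] cardH cutH]]]]].
have [[eH_sym eH_irr] cH_sym cH_ge0 tH_inj H_conn] := netH.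
have phi_inj u v x : x \in phi u -> x \in phi v -> u = v.
  move=> xu xv; apply/eqP; apply: contraT => /phid /pred0P /(_ x).
  by rewrite /= xu xv.
pose g0 u v := odflt (td i0, td i0)
  [pick p : dv * dv | [&& p.1 \in phi u, p.2 \in phi v & de p.1 p.2]].
have g0P u v : eH u v -> [&& (g0 u v).1 \in phi u, (g0 u v).2 \in phi v & de (g0 u v).1 (g0 u v).2].
  move=> /phie[x [y [xu yv xy]]]; rewrite /g0; case: pickP => //= /(_ (x, y)).
  by rewrite /= xu yv xy.
(* Ordering the pair makes both directions of an edge of H choose the same dual edge. *)
pose g u v := if (enum_rank u < enum_rank v)%N then g0 u v else ((g0 v u).2, (g0 v u).1).
have gP u v : eH u v -> [/\ (g u v).1 \in phi u, (g u v).2 \in phi v & de (g u v).1 (g u v).2].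
  move=> uv; rewrite /g; case: ifP => _; first exact/and3P/g0P.
  have /and3P[? ? ?] : [&& (g0 v u).1 \in phi v, (g0 v u).2 \in phi u & de (g0 v u).1 (g0 v u).2].
    by apply: g0P; rewrite eH_sym.
  by split=> //=; rewrite dual_edge_sym.
have g_1 u v (uv : eH u v) : (g u v).1 \in phi u by case: (gP u v uv).
have g_2 u v (uv : eH u v) : (g u v).2 \in phi v by case: (gP u v uv).
have g_de u v (uv : eH u v) : de (g u v).1 (g u v).2 by case: (gP u v uv).
have g_sym u v : eH u v -> g v u = ((g u v).2, (g u v).1).
  move=> uv; rewrite /g; case: (ltngtP (enum_rank u) (enum_rank v)) => //=.
  - by rewrite -surjective_pairing.
  - by move=> /val_inj/enum_rank_inj E; rewrite E eH_irr in uv.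
pose T := cvertex rev tail t eH phi g i0.
exists T, (cedge (i0 := i0)), (clength cH (i0 := i0)),
  (ct revK rev_neq term_cob eH_sym cH_sym cH_ge0 phi_inj phit g_1 g_2 g_sym tH_inj i0
     terminals_separated); split.
- exact: (contracted_network revK rev_neq t_inj list_cob term_cob eH_sym cH_sym cH_ge0
    phi_inj phic phit g_1 g_2 g_de g_sym tH_inj H_conn i0 terminals_separated).
- apply: contracted_minor => d; by case/andP: (valP d).
- have ccard := card_cvertex revK rev_neq t_inj list_cob eH_sym cH_sym cH_ge0
    phi_inj phic phit g_1 g_2 g_de g_sym tH_inj H_conn eH_irr i0 tail_psi.
  apply: (@le_trans _ _ (3 * #|VH|)%:R); first by rewrite ler_nat.
  by rewrite natrM ler_wpM2l.
- have cdist := dist_ct revK rev_neq t_inj list_cob term_cob eH_sym cH_sym cH_ge0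
    phi_inj phic phit g_1 g_2 g_de g_sym tH_inj H_conn eH_irr i0 terminals_separated.
  (* For [i = j] the sets [S] are trivial and the cut hypothesis says nothing about them, but both
     distances are 0. *)
  move=> i j; rewrite cdist; have [ij|ij] := eqVneq i j.
    have cost0 (c' : dv * dv -> R) (P : seq (dv * dv) -> Prop) : P [::] -> (forall z, 0 <= c' z) ->
        inf [set r | exists l, P l /\ r = \sum_(z <- l) c' z]%classic = 0.
      move=> P0 c0; apply: inf_eq0; first by exists [::]; rewrite big_nil.
      by move=> _ [l [_ ->]]; apply: sumr_ge0.
    rewrite dist_gwalk !cost0 ?mulr0 ?lexx // -?ij /= ?eqxx // => z.
      exact: cost_ge0.
    by apply: cost_ge0; exact: dual_weight_ge0.
  have [S sS] := terminals_separated i j.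
  have [S0 ST] := separates_proper ij sS.
  rewrite (dist_mincut_dual sS).
  rewrite -(mincut_gwalk revK rev_neq t_inj list_cob term_cob eH_sym cH_sym cH_ge0
    phi_inj phic phit g_1 g_2 g_de g_sym th_trans tH_inj sS).
  exact: cutH.
Qed.

End PlaneNetwork.

(** * From a rotation system to the dual network *)

Lemma card_face (D : finType) (psi : {perm D}) : #|{: face psi}| = #|porbits psi|.
Proof.
rewrite card_sig -fcard_porbits; apply: eq_card => d; by rewrite !inE andbT.
Qed.

Lemma card_porbits_rotation (V : finType) (e : rel V) (sigma : {perm dart e}) :
  rotation_system sigma -> (forall v, exists d : dart e, dart_tail d = v) ->
  #|porbits sigma| = #|V|.
Proof.
move=> [st sc] hd; pose h v := [set d : dart e | dart_tail d == v].
have hE d : porbit sigma d = h (dart_tail d).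
  apply/setP => d'; rewrite inE -fconnect_porbit; apply/idP/eqP => [|E]; last exact/sc/esym.
  by rewrite fconnect_porbit; apply: porbit_invariant.
have hinj : injective h.
  move=> u v E; have [d du] := hd u.
  have : d \in h u by rewrite inE du.
  by rewrite E inE du => /eqP.
rewrite -(card_imset [pred v : V | true] hinj); apply: eq_card => X; apply/imsetP/imsetP.
  by case=> d _ ->; exists (dart_tail d) => //; exact: hE.
by case=> v _ ->; have [d <-] := hd v; exists d.
Qed.

Lemma sparsifiers_give_DAM (V : finType) (e : rel V) (c : V -> V -> R) (k : nat)
    (t : 'I_k -> V) (q s : R) : (1 < k)%N ->
  is_network e c t -> planar_terminals_one_face e t ->
  (forall (V' : finType) (e' : rel V') (c' : V' -> V' -> R) (t' : 'I_k -> V'),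
     is_network e' c' t' -> planar_terminals_one_face e' t' ->
     has_minor_cut_sparsifier e' c' t' q s) ->
  has_DAM e c t q (3%:R * s).
Proof.
move=> k2 net [sigma [rs genus [d0 oneface]]] sparsify.
have [[e_sym e_irr] c_sym c_ge0 t_inj e_conn] := net; have [sig_tail sig_conn] := rs.
pose rev := @dart_rev V e; pose tail := @dart_tail V e.
have revK : involutive rev := @dart_revK V e.
have rev_neq d : rev d != d.
  apply/eqP => /(congr1 val); case: d => [[x y] xy] /= [E _]; move: xy.
  by rewrite /dartP /= E e_irr.
pose i0 : 'I_k := Ordinal (ltnW k2); pose i1 : 'I_k := Ordinal k2.
have e_dartP x y : e x y -> exists d : dart e, tail d = x /\ tail (rev d) = y.
  move=> xy; have dxy : dartP e (x, y) by rewrite /dartP /= xy e_sym.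
  by exists (exist (fun p => dartP e p) (x, y) dxy).
(* A vertex without darts would escape the count of orbits of [sigma]; connectivity and two distinct
   terminals exclude it. *)
have all_dart v : exists d : dart e, tail d = v.
  have [w vw] : exists w, v != w.
    case: (eqVneq v (t i0)) => [->|]; last by exists (t i0).
    by exists (t i1); apply/eqP => /t_inj.
  have /connectP[[|u p] /= ] := e_conn v w; first by move=> _ E; rewrite E eqxx in vw.
  by case/andP => /e_dartP[d [<- _]] _ _; exists d.
have G_conn (h : V -> bool) : (forall d, h (tail d) = h (tail (rev d))) -> forall x y, h x = h y.
  move=> hd x y; have /connectP[p] := e_conn x y.
  elim: p x => [x _ -> //|z p IH x /= /andP[/e_dartP[d [<- zd]] pp] yE].
  by rewrite hd zd; exact: IH pp yE.
have [dt0 dtP] : exists dt : 'I_k -> dart e,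
    forall i, fconnect (face_perm sigma) d0 (dt i) /\ tail (dt i) = t i.
  exact: fin_all_exists oneface.
pose psi0 : {perm dart e} := perm (@face_perm_inj _ _ sigma).
have psi0E : psi0 =1 face_perm sigma by move=> d; rewrite permE.
have tail_dt i : tail (dt0 i) = t i by case: (dtP i).
have dt_inj : injective dt0 by move=> i j E; apply: t_inj; rewrite -!tail_dt E.
have [a [l al]] : exists a l, codom dt0 = a :: l.
  have := size_codom dt0; rewrite card_ord; case: (codom dt0) => [k0|a l _]; last by exists a, l.
  by move: (k2); rewrite -k0.
have sl : (size l).+1 = k by rewrite -[(size l).+1]/(size (a :: l)) -al size_codom card_ord.
have memP d : reflect (exists i, d = dt0 i) (d \in a :: l) by rewrite -al; exact: codomP.
have dt_in i : dt0 i \in a :: l by apply/memP; exists i.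
have [||||tau [tau_id tau_tr cpsi dpsi [csig osig]]] :=
  @orbit_splitting_cycle (dart e) V psi0 sigma tail a l.
- by rewrite -al; apply/injectiveP.
- have pc x : x \in a :: l -> fconnect psi0 d0 x.
    by move=> /memP[i ->]; rewrite (eq_fconnect psi0E); case: (dtP i).
  move=> x xl; rewrite -fconnect_porbit; apply: connect_trans (pc _ xl).
  by rewrite fconnect_sym ?pc ?inE ?eqxx //; exact: perm_inj.
- exact: sig_tail.
- by move=> x y /memP[i ->] /memP[j ->]; rewrite !tail_dt => /t_inj ->.
have [th tau_dt] : exists th : 'I_k -> 'I_k, forall i, tau (dt0 i) = dt0 (th i).
  apply: (@fin_all_exists _ (fun=> 'I_k) (fun i j => tau (dt0 i) = dt0 j)) => i; apply/memP.
  apply: contraT => nt.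
  by have /perm_inj E := tau_id _ nt; rewrite E dt_in in nt.
(* The orbits of [psi] are the faces after splitting the outer one; those of [psi \o rev], which is
   [sigma * tau], are the vertices after fusing the terminals. *)
pose psi : {perm dart e} := (psi0 * tau)%g.
have psi_rev d : psi (rev d) = tau (sigma d) by rewrite permM psi0E /face_perm dart_revK.
have tau_id' d : d \notin codom dt0 -> tau d = d by rewrite al; exact: tau_id.
have sig_trans (P : dart e -> bool) : (forall d, P (sigma d) = P d) ->
    forall x y, tail x = tail y -> P x = P y.
  move=> Ps x y /sig_conn; rewrite fconnect_porbit => xy; exact/esym/(porbit_invariant Ps xy).
have dt_trans (P : dart e -> bool) : (forall d, P (tau (sigma d)) = P d) ->
    forall i j, P (dt0 i) = P (dt0 j).
  move=> Ps; have Ps' d : P ((sigma * tau)%g d) = P d by rewrite permM.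
  by move=> i j; rewrite !(porbit_invariant Ps' (osig _ (dt_in _))).
have conn_dual := dual_connected sig_trans psi_rev tau_dt tau_id' dt_trans G_conn.
have cV : #|porbits sigma| = #|V| by exact: card_porbits_rotation.
have cF : #|porbits psi0| = fcard (face_perm sigma) predT.
  by rewrite -fcard_porbits; apply: eq_fcard.
have cPsi : #|{: face psi}| = (fcard (face_perm sigma) predT + size l)%N.
  by rewrite card_face cpsi cF.
have cS : fcard (psi \o rev) predT = #|porbits (sigma * tau)%g|.
  by rewrite -(fcard_porbits (sigma * tau)%g); apply: eq_fcard => d; rewrite /= psi_rev permM.
have cSig : (fcard (psi \o rev) predT + size l = #|V|)%N.
  by rewrite cS; apply: etrans csig cV.
(* The terminals are counted here as [k] distinct vertices, so the total exceeds Euler's by the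
   [k - 1] new faces. *)
have euler : (2 * #|{: face psi}| + 2 * #|V| = #|{: dart e}| + 2 + 2 * k)%N.
  have arith f m v d : (2 * v + 2 * f = d + 4 -> 2 * (f + m) + 2 * v = d + 2 + 2 * m.+1)%N by lia.
  by rewrite cPsi -sl; exact: arith genus.
(* Fusing the terminals loses as many vertices as the splitting gains faces, so the genus stays
   0. *)
have euler_dual : (2 * #|{: face psi}| + 2 * fcard (psi \o rev) predT = #|{: dart e}| + 4)%N.
  have arith f m v d x : (2 * v + 2 * f = d + 4 -> x + m = v -> 2 * (f + m) + 2 * x = d + 4)%N.
    by lia.
  by rewrite cPsi; exact: arith genus cSig.
have vcob := vertex_coboundary sig_tail psi_rev t_inj tail_dt tau_dt tau_id'.
have ccob := closed_chain_coboundary i0 revK rev_neq sig_tail sig_trans psi_rev t_inj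
  tail_dt tau_dt tau_id' dt_trans G_conn euler.
have lcob := closed_list_coboundary revK t_inj ccob vcob.
have tcob := terminal_coboundary vcob.
have th_trans (P : 'I_k -> bool) : (forall m, P (th m) = P m) -> forall m n, P m = P n.
  move=> Pth; pose P' d := [exists m, (d == dt0 m) && P m].
  have P'E m : P' (dt0 m) = P m.
    apply/existsP/idP => [[n /andP[/eqP /dt_inj -> //]]|Pm]; by exists m; rewrite eqxx.
  have P'tau d : P' (tau d) = P' d.
    by case: (boolP (d \in a :: l)) => [/memP[m ->]|/tau_id -> //]; rewrite tau_dt !P'E.
  by move=> m n; rewrite -!P'E !(tau_tr _ P'tau _ (dt_in _)).
have tail_psi (Y : V -> 'F_2) : (forall i, Y (t i) = 0) ->
    forall d, Y (tail (psi d)) = Y (tail (rev d)).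
  move=> Yt d; have sr : tail (sigma (rev d)) = tail (rev d) := sig_tail _.
  rewrite permM psi0E /face_perm -/rev -sr.
  case: (boolP (sigma (rev d) \in a :: l)) => [/memP[i E]|/tau_id -> //].
  by rewrite E tau_dt !tail_dt !Yt.
have td_inj : injective (dual_terminal psi dt0).
  have inl_inj (w w' : face psi) : (inl w : dual_vertex psi) = inl w' -> w = w'.
    exact: (congr1 (fun x => if x is inl y then y else w)).
  move=> i j /inl_inj /eqP; rewrite face_of_eq fconnect_porbit porbit_sym => E.
  by apply: dt_inj; exact: dpsi.
have de_sym := @dual_edge_sym _ rev psi revK.
apply: (@sparsified_dual_DAM V e c psi k t dt0 th i0 net td_inj rev_neq lcob tcob th_trans
  tail_psi).
apply: sparsify.
  split=> //.
  - split=> //; exact: dual_edge_irr.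
  - exact: (dual_weight_sym net).
  - exact: (dual_weight_ge0 net).
  - exact: dual_network_connected.
apply: (dual_planar revK (dt := dt0) (i0 := i0) euler_dual) => i.
have E d : (psi \o rev) d = (sigma * tau)%g d by rewrite /= psi_rev permM.
rewrite (eq_fconnect E) fconnect_porbit -eq_porbit_mem.
have porbit_a j : porbit (sigma * tau)%g (dt0 j) = porbit (sigma * tau)%g a.
  by apply/eqP; rewrite eq_porbit_mem; exact: osig.
by rewrite !porbit_a.
Qed.

Theorem theoremG2 :
  exists C : R, forall (k : nat) (q s : R), (2 <= k)%N -> 1 <= q -> k%:R <= s ->
    (forall (V : finType) (e : rel V) (c : V -> V -> R) (t : 'I_k -> V),
        is_network e c t -> planar_terminals_one_face e t ->
        has_minor_cut_sparsifier e c t q s) ->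
    (forall (V : finType) (e : rel V) (c : V -> V -> R) (t : 'I_k -> V),
        is_network e c t -> planar_terminals_one_face e t ->
        has_DAM e c t q (C * s)).
Proof.
exists 3%:R => k q s k2 _ _ sparsify V e c t net planar.
exact: sparsifiers_give_DAM sparsify.
Qed.
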